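(* Let $(u^\epsilon,v^\epsilon)_{\epsilon>0}$ be the solutions of the scalar viscous self-similar Riemann problem described in the context. Up to extracting a subsequence as $\epsilon\to0$, $u^\epsilon$ converges pointwise to a function $u\in BV(\mathbb{R})$ (bounded variation on $\mathbb R$), $$u^\epsilon(\xi)\to u(\xi),\qquad \xi\in\mathbb{R},$$ which satisfies, in the sense of distributions, the conservation laws $$-\xi\,\frac{d}{d\xi}\gamma_-(u)+\frac{d}{d\xi}f_-(\gamma_-(u))=0,\quad \xi<0,\qquad\qquad -\xi\,\frac{d}{d\xi}\gamma_+(u)+\frac{d}{d\xi}f_+(\gamma_+(u))=0,\quad \xi>0,$$ and the entropy inequalities $$-\xi\,\frac{d}{d\xi}\eta(\gamma_-(u))+\frac{d}{d\xi}q_-(\gamma_-(u))\le0,\quad \xi<0,\qquad -\xi\,\frac{d}{d\xi}\eta(\gamma_+(u))+\frac{d}{d\xi}q_+(\gamma_+(u))\le0,\quad \xi>0,$$ for all convex entropy functions $\eta$ and associated entropy fluxes $q_\pm$ with $q_\pm'=\eta' f_\pm'$, together with the boundary conditions $u(-\infty)=u_L$ and $u(+\infty)=u_R$.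
   Context: Here $u_L,u_R\in\mathbb{R}$, $p>0$, $\Omega:=[\min(u_L,u_R),\max(u_L,u_R)]$, and $A_0,A_1,B_0$ are smooth scalar-valued functions of $(u,v)$ such that, for some constants $c_1,c_2,c_3$, $$0<c_1\le A_0(u,v),\qquad 0<c_2\le B_0(u,v)\le c_3.$$ They satisfy the consistency conditions $A_0(u,\pm1)=\gamma_\pm'(u)$ and $A_1(u,\pm1)=(f_\pm\circ\gamma_\pm)'(u)$, where $f_-,f_+$ are smooth scalar flux functions and $\gamma_-,\gamma_+$ are given smooth invertible functions on $\mathbb{R}$. Set $\lambda:=A_1/A_0$ and $G:=A_0/B_0$. Let $\Lambda>0$ be such that $|\lambda(u,v)|\le\Lambda$ for $(u,v)\in\Omega\times[-1,1]$, and fix $M>\Lambda$. For each $\epsilon>0$, $(u^\epsilon,v^\epsilon)\in C^0([-M,M],\Omega\times[-1,1])$ is a solution of $$\big(-\xi A_0(u^\epsilon,v^\epsilon)+A_1(u^\epsilon,v^\epsilon)\big)u^\epsilon_\xi=\epsilon\big(B_0(u^\epsilon,v^\epsilon)u^\epsilon_\xi\big)_\xi,\qquad -\xi v^\epsilon_\xi=\epsilon^p v^\epsilon_{\xi\xi},$$ with $u^\epsilon(-M)=u_L$, $u^\epsilon(M)=u_R$, $v^\epsilon(-\infty)=-1$, $v^\epsilon(+\infty)=1$, that is, $$u^\epsilon(\xi)=u_L+(u_R-u_L)\frac{\int_{-M}^{\xi}e^{-h^\epsilon(\zeta)/\epsilon}B_0(u^\epsilon,v^\epsilon)^{-1}d\zeta}{\int_{-M}^{M}e^{-h^\epsilon(\zeta)/\epsilon}B_0(u^\epsilon,v^\epsilon)^{-1}d\zeta},\qquad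 v^\epsilon(\xi)=-1+2\frac{\int_{-\infty}^{\xi}e^{-\zeta^2/(2\epsilon^p)}d\zeta}{\int_{-\infty}^{\infty}e^{-\zeta^2/(2\epsilon^p)}d\zeta},$$ where $h^\epsilon(\xi)=\int_\alpha^\xi(\zeta-\lambda(u^\epsilon,v^\epsilon))G(u^\epsilon,v^\epsilon)\,d\zeta$ for an arbitrary $\alpha\in[-M,M]$. The function $u^\epsilon$ is extended to $\mathbb{R}$ by $u^\epsilon=u_L$ for $\xi\le-M$ and $u^\epsilon=u_R$ for $\xi\ge M$. Derivatives of $\gamma_\pm(u)$, $f_\pm(\gamma_\pm(u))$, etc. are distributional derivatives (measures). *)

(* Defs.v *)
From mathcomp Require Import all_boot all_order all_algebra.
From mathcomp Require Import all_classical all_reals all_analysis.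

Set Implicit Arguments.
Unset Strict Implicit.
Unset Printing Implicit Defensive.

Import Order.TTheory GRing.Theory Num.Theory.
Import numFieldNormedType.Exports.

Local Open Scope classical_set_scope.
Local Open Scope ring_scope.

Definition smooth (R : realType) (f : R -> R) : Prop :=
  forall (n : nat) (x : R), derivable (derive1n n f) x 1.

Fixpoint isC (R : realType) (k : nat) (F : R * R -> R) : Prop :=
  continuous F /\
  (if k is k'.+1 then
     [/\ forall z, derivable F z (1, 0), forall z, derivable F z (0, 1),
         isC k' (fun z => 'D_(1, 0) F z) & isC k' (fun z => 'D_(0, 1) F z)]
   else True).

Definition smooth2 (R : realType) (F : R -> R -> R) : Prop :=
  forall k : nat, isC k (fun z : R * R => F z.1 z.2).

(* The library has no oriented integral, and its integral over `[a, b] is 0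
   when b < a. *)
Definition oriented_int (R : realType) (a b : R) (f : R -> R) : R :=
  if a <= b then \int[@lebesgue_measure R]_(x in `[a, b]) f x
  else - \int[@lebesgue_measure R]_(x in `[b, a]) f x.

Definition Omega (R : realType) (uL uR : R) : set R :=
  `[Num.min uL uR, Num.max uL uR]%classic.

Definition lam (R : realType) (A0 A1 : R -> R -> R) (a b : R) : R :=
  A1 a b / A0 a b.

Definition Gfun (R : realType) (A0 B0 : R -> R -> R) (a b : R) : R :=
  A0 a b / B0 a b.

Definition hfun (R : realType) (A0 A1 B0 : R -> R -> R) (u v : R -> R)
    (alpha xi : R) : R :=
  oriented_int alpha xi
    (fun z => (z - lam A0 A1 (u z) (v z)) * Gfun A0 B0 (u z) (v z)).

Definition u_weight (R : realType) (A0 A1 B0 : R -> R -> R) (eps : R)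
    (u v : R -> R) (alpha z : R) : R :=
  expR (- hfun A0 A1 B0 u v alpha z / eps) * (B0 (u z) (v z))^-1.

Definition v_weight (R : realType) (p eps z : R) : R :=
  expR (- (z ^+ 2 / (2 * eps `^ p))).

(* The differential equations and the integral representation are equivalent
   descriptions of a solution; both are recorded. *)
Record viscous_solution (R : realType) (uL uR p M : R)
    (A0 A1 B0 : R -> R -> R) (eps : R) (u v : R -> R) : Prop :=
  ViscousSolution {
  vs_u_cont : {within `[- M, M], continuous u};
  vs_v_cont : {within `[- M, M], continuous v};
  vs_u_range : forall xi : R, xi \in `[- M, M] -> Omega uL uR (u xi);
  vs_v_range : forall xi : R, xi \in `[- M, M] -> v xi \in `[-1, 1];
  vs_u_derivable : forall xi : R, xi \in `]- M, M[ -> derivable u xi 1;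
  vs_u_flux_derivable : forall xi : R, xi \in `]- M, M[ ->
    derivable (fun z : R => B0 (u z) (v z) * derive1 u z) xi 1;
  vs_u_ode : forall xi : R, xi \in `]- M, M[ ->
    (- xi * A0 (u xi) (v xi) + A1 (u xi) (v xi)) * derive1 u xi =
    eps * derive1 (fun z : R => B0 (u z) (v z) * derive1 u z) xi;
  vs_v_derivable : forall xi : R, derivable v xi 1;
  vs_v_derivable2 : forall xi : R, derivable (derive1 v) xi 1;
  vs_v_ode : forall xi : R, - xi * derive1 v xi = eps `^ p * derive1n 2 v xi;
  vs_u_left : u (- M) = uL;
  vs_u_right : u M = uR;
  vs_v_left : v xi @[xi --> -oo] --> (-1 : R);
  vs_v_right : v xi @[xi --> +oo] --> (1 : R);
  vs_u_formula : forall alpha xi : R, alpha \in `[- M, M] -> xi \in `[- M, M] ->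
    u xi = uL + (uR - uL) *
      ((\int[@lebesgue_measure R]_(z in `[(- M), xi])
          u_weight A0 A1 B0 eps u v alpha z) /
       (\int[@lebesgue_measure R]_(z in `[(- M), M])
          u_weight A0 A1 B0 eps u v alpha z));
  vs_v_formula : forall xi : R,
    v xi = -1 + 2 *
      ((\int[@lebesgue_measure R]_(z in `]-oo, xi]) v_weight p eps z) /
       (\int[@lebesgue_measure R]_z v_weight p eps z));
  vs_u_extl : forall xi : R, xi <= - M -> u xi = uL;
  vs_u_extr : forall xi : R, M <= xi -> u xi = uR
}.

Definition BV_line (R : realType) (f : R -> R) : Prop :=
  (ereal_sup [set total_variation ab.1 ab.2 f
             | ab in [set ab : R * R | (ab.1 <= ab.2)%R]] < +oo)%E.

Definition test_function (R : realType) (D : set R) (phi : R -> R) : Prop :=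
  smooth phi /\
  exists K : set R,
    [/\ compact K, K `<=` D & forall x, ~ K x -> phi x = 0].

(* The action on phi of the distributional derivative of w. *)
Definition ddx (R : realType) (w : R -> R) (phi : R -> R) : R :=
  - \int[@lebesgue_measure R]_x (w x * derive1 phi x).

(* The action on phi of - xi * dw/dxi + dF/dxi; a distribution is multiplied
   by the smooth function - xi by multiplying the test function. *)
Definition selfsimilar (R : realType) (w F : R -> R) (phi : R -> R) : R :=
  ddx w (fun x => - x * phi x) + ddx F phi.

Definition distr_eq0 (R : realType) (D : set R) (T : (R -> R) -> R) : Prop :=
  forall phi, test_function D phi -> T phi = 0.

Definition distr_le0 (R : realType) (D : set R) (T : (R -> R) -> R) : Prop :=
  forall phi, test_function D phi -> (forall x, 0 <= phi x) -> T phi <= 0.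

Definition entropy_flux (R : realType) (eta f q : R -> R) : Prop :=
  forall x, derivable q x 1 /\ derive1 q x = derive1 eta x * derive1 f x.

(* Main.v *)
Require Import Defs.
From mathcomp Require Import all_boot all_order all_algebra.
From mathcomp Require Import all_classical all_reals all_analysis.
From mathcomp Require Import measurable_realfun ring lra.
Import Order.TTheory GRing.Theory Num.Theory.
Import numFieldNormedType.Exports.
Local Open Scope classical_set_scope.
Local Open Scope ring_scope.

Set Implicit Arguments.
Unset Strict Implicit.
Unset Printing Implicit Defensive.

(** The whole argument rests on the viscous flux [w = B0 (u, v) * u'], for which
    the equation reads [eps * w' = (- x * A0 + A1) * u'].

    Monotone profiles. Since [u' = w / B0], this is a linear homogeneous equation
    for [w], so [w] keeps one sign ([linear_ode_pos]). Every profile is therefore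
    monotone between [uL] and [uR], in a direction [s = 1] or [s = -1] that is
    the same for all [eps], and Helly's theorem ([helly_selection]) extracts a
    subsequence that converges at every point to a monotone [u0].

    Decay. Where the equation gives [eps * w' >= k * u' >= 0], the quantity
    [eps * w - k * u] increases while [w] is controlled by the increment of [u]
    further to the right; hence [u] oscillates by [O(eps)] only
    ([decay_estimate]). Used for [u] beyond the maximal speed [Lambda], this
    shows that [u0] is [uL] or [uR] there. Used for [v], whose equation
    [- x * v' = eps^p * v''] has the same form with flux [v'], it shows that [v]
    tends to [-1] or [1] uniformly away from the origin; the coefficients
    [A0 (u, v)], [A1 (u, v)] are then uniformly close to [gamma'] and
    [(f \o gamma)'], at the value [u].

    Entropy. Put [E = eta \o gamma], [Q = q \o gamma], [g = eta' \o gamma], so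
    that [E' = g * gamma'] and [Q' = g * (f \o gamma)']. Multiplying the
    equation by [g u * phi] and integrating by parts leaves three terms: a
    boundary term, the term [- eps * (g u)' * w * phi], which is nonpositive
    because [g] is nondecreasing and [u' * w >= 0], and terms bounded by
    ([eps] + the error on the coefficients) times the total variation of [u]
    ([entropy_balance]). Bounded convergence then passes to the limit
    ([entropy_limit]). As [eta'] need not be differentiable, the multiplier is
    a difference quotient of [eta] ([convex_derive1_approx]). A test function
    supported in a half-line may reach beyond [M] or [-M], where the equation
    stops; the integral is cut at a point at distance between [Lambda] and [M]
    from the origin, beyond which [u0] is constant ([weak_form_left], [weak_form_right]). The conservation
    laws are the entropy inequalities of the two entropies [id] and [- id],
    for which [g] is constant and [phi] may change sign. *)

(** * First-order differential inequalities *)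

Lemma is_derive_continuous (R : realType) (f : R -> R) (x df : R) :
  is_derive x 1 f df -> {for x, continuous f}.
Proof. by case=> fd _; exact/differentiable_continuous/derivable1_diffP. Qed.

Lemma is_derive_continuousT (R : realType) (f df : R -> R) :
  (forall x : R, is_derive x 1 f (df x)) -> continuous f.
Proof. by move=> fd x; exact: is_derive_continuous (fd x). Qed.

Lemma is_derive_derive1 (R : realType) (f : R -> R) (x : R) :
  derivable f x 1 -> is_derive x 1 f (derive1 f x).
Proof. by move=> fd; rewrite derive1E; exact/derivableP. Qed.

Lemma normr_sqr1 (R : realType) (s : R) : s * s = 1 -> `|s| = 1.
Proof. by move=> s1; apply/eqP; rewrite -sqr_norm_eq1 expr2 s1. Qed.

Lemma is_derive_within_continuous (R : realType) (f df : R -> R) (a b : R) :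
  (forall x : R, x \in `[a, b] -> is_derive x 1 f (df x)) ->
  {within `[a, b], continuous f}.
Proof.
move=> fd; apply: continuous_in_subspaceT => x /set_mem xab.
exact: is_derive_continuous (fd x xab).
Qed.

Lemma le_of_derive_ge0 (R : realType) (f df : R -> R) (a b : R) : a <= b ->
  (forall x : R, x \in `]a, b[ -> is_derive x 1 f (df x)) ->
  {within `[a, b], continuous f} ->
  (forall x : R, x \in `]a, b[ -> 0 <= df x) -> f a <= f b.
Proof.
move=> ab fd fc df0; have [<-//|nab] := eqVneq a b.
have [|c cab] := MVT _ fd fc; first by rewrite lt_neqAle nab.
by move=> E; rewrite -subr_ge0 E mulr_ge0 ?df0// subr_ge0.
Qed.

Lemma le_of_derive_ge0_cc (R : realType) (f df : R -> R) (a b : R) : a <= b ->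
  (forall x : R, x \in `[a, b] -> is_derive x 1 f (df x)) ->
  (forall x : R, x \in `[a, b] -> 0 <= df x) -> f a <= f b.
Proof.
move=> ab fd df0.
have fd' (x : R) : x \in `]a, b[ -> is_derive x 1 f (df x).
  by move=> xab; apply: fd; apply: subset_itv_oo_cc.
have fc := is_derive_within_continuous fd.
have df0' (x : R) : x \in `]a, b[ -> 0 <= df x.
  by move=> xab; apply: df0; apply: subset_itv_oo_cc.
exact (le_of_derive_ge0 ab fd' fc df0').
Qed.

(** Under [|w'| <= k * |w|], [w ^+ 2 * expR (2 * k * x)] is nondecreasing and
    [w ^+ 2 * expR (- 2 * k * x)] nonincreasing, so a nonzero value of [w] at
    one point excludes zeros on either side of it. *)
Lemma linear_ode_pos (R : realType) (w dw : R -> R) (k l r x0 : R) :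
  (forall x : R, x \in `]l, r[ -> is_derive x 1 w (dw x)) ->
  (forall x : R, x \in `]l, r[ -> `|dw x| <= k * `|w x|) ->
  x0 \in `]l, r[ -> 0 < w x0 -> forall x : R, x \in `]l, r[ -> 0 < w x.
Proof.
move=> wd dwk x0I wx0.
have sub a b : a \in `]l, r[ -> b \in `]l, r[ ->
    forall x : R, x \in `[a, b] -> x \in `]l, r[.
  move=> /itvP aI /itvP bI x /itvP xI; rewrite in_itv/=; apply/andP; split.
    by apply: (@lt_le_trans _ _ a); rewrite ?aI ?xI.
  by apply: (@le_lt_trans _ _ b); rewrite ?bI ?xI.
have ineq y : y \in `]l, r[ -> `|w y * dw y| <= k * w y ^+ 2.
  move=> yI; rewrite normrM -(real_normK (num_real (w y))) expr2 mulrA mulrC.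
  by rewrite ler_wpM2r// dwk.
have dg c y : y \in `]l, r[ -> is_derive y 1
    (fun y => w y ^+ 2 * expR (c * y))
    ((2 * (w y * dw y) + c * w y ^+ 2) * expR (c * y)).
  move=> yI; have ? := wd _ yI.
  by apply: is_derive_eq; rewrite /GRing.scale/=; ring.
have w0 x : x \in `]l, r[ -> w x != 0.
  move=> xI; rewrite -sqrf_eq0; apply: lt0r_neq0.
  have [x0x|/ltW xx0] := leP x0 x.
  - rewrite -(pmulr_lgt0 _ (expR_gt0 (2 * k * x))) mulrC.
    apply: (@lt_le_trans _ _ (w x0 ^+ 2 * expR (2 * k * x0))).
      by rewrite mulr_gt0// ?expR_gt0// exprn_gt0.
    rewrite [leRHS]mulrC; have subx := sub _ _ x0I xI.
    have gd y yI := dg (2 * k) y (subx y yI).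
    have := le_of_derive_ge0_cc x0x gd; apply => y /subx yI.
    rewrite mulr_ge0 ?expR_ge0//; have := ineq _ yI; rewrite ler_norml; lra.
  - rewrite -(pmulr_lgt0 _ (expR_gt0 (- (2 * k) * x))) mulrC.
    apply: (@lt_le_trans _ _ (w x0 ^+ 2 * expR (- (2 * k) * x0))).
      by rewrite mulr_gt0// ?expR_gt0// exprn_gt0.
    rewrite -lerN2 [X in - X <= _]mulrC; have subx := sub _ _ xI x0I.
    have gd y yI := is_deriveN (dg (- (2 * k)) y (subx y yI)).
    have := le_of_derive_ge0_cc xx0 gd; apply => y /subx yI.
    rewrite -mulNr mulr_ge0 ?expR_ge0//; have := ineq _ yI; rewrite ler_norml; lra.
move=> x xI; rewrite lt_neqAle eq_sym w0//=; apply/negP => /negP; rewrite -ltNge => wx.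
have cw a b : a \in `]l, r[ -> b \in `]l, r[ -> {within `[a, b], continuous w}.
  move=> aI bI.
  exact (is_derive_within_continuous (fun y yI => wd y (sub _ _ aI bI y yI))).
have [x0x|/ltW xx0] := leP x0 x.
- have [|c cI wc] := @IVT _ w x0 x 0 x0x (cw _ _ x0I xI).
    by rewrite ge_min le_max (ltW wx) (ltW wx0) ?orbT.
  by have := w0 c (sub _ _ x0I xI _ cI); rewrite wc eqxx.
- have [|c cI wc] := @IVT _ w x x0 0 xx0 (cw _ _ xI x0I).
    by rewrite ge_min le_max (ltW wx) (ltW wx0) ?orbT.
  by have := w0 c (sub _ _ xI x0I _ cI); rewrite wc eqxx.
Qed.

(** The first bound holds because [eps * w - k * u] is nondecreasing and
    [w y >= 0]. The second holds because [w] itself is nondecreasing, hence [c * u' >= w x] on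
    [`[x, r]]. Together they bound the oscillation of [u] to the left of [x] by
    [eps * c * (u r - u x) / (k * (r - x))]. *)
Lemma decay_estimate (R : realType) (u du w dw : R -> R) (eps k c l r x : R) :
  0 < c -> 0 <= k -> 0 < eps ->
  (forall x : R, x \in `]l, r] -> is_derive x 1 u (du x)) ->
  (forall x : R, x \in `]l, r[ -> is_derive x 1 w (dw x)) ->
  (forall x : R, x \in `]l, r[ -> 0 <= w x <= c * du x) ->
  (forall x : R, x \in `]l, r[ -> k * du x <= eps * dw x) ->
  x \in `]l, r[ ->
  (forall y : R, y \in `]l, x] -> k * (u x - u y) <= eps * w x) /\
  w x * (r - x) <= c * (u r - u x).
Proof.
move=> c0 k0 e0 ud wd wB ode xI; have /itvP xI' := xI.
have oc (z : R) : z \in `]l, r[ -> z \in `]l, r].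
  by move=> /itvP zI; rewrite in_itv/= !zI.
split.
  move=> y /itvP yI; have yx : y <= x by rewrite yI.
  have sub z : z \in `[y, x] -> z \in `]l, r[.
    move=> /itvP zI; rewrite in_itv/= (@lt_le_trans _ _ y) ?yI ?zI//=.
    by rewrite (@le_lt_trans _ _ x) ?xI' ?zI.
  have fd z (zI : z \in `[y, x]) := is_deriveB
    (is_deriveZ eps (wd z (sub z zI))) (is_deriveZ k (ud z (oc z (sub z zI)))).
  have := le_of_derive_ge0_cc yx fd.
  have wy : 0 <= w y.
    by have /wB/andP[] : y \in `]l, r[ by apply: sub; rewrite in_itv/= lexx.
  have ewy : 0 <= eps * w y by rewrite mulr_ge0// ltW.
  move=> H; have {H} : eps * w y - k * u y <= eps * w x - k * u x.
    by apply: H => z /sub zI; rewrite subr_ge0; exact: ode.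
  lra.
have du0 z : z \in `]l, r[ -> 0 <= du z.
  by move=> /wB /andP[w0]; move/(le_trans w0); rewrite pmulr_rge0.
have sub z : z \in `]x, r[ -> z \in `]l, r[.
  by move=> /itvP zI; rewrite in_itv/= (@lt_trans _ _ x) ?zI ?xI'.
have xr : x <= r by rewrite xI'.
have sub1 z : z \in `[x, r] -> z \in `]l, r].
  by move=> /itvP zI; rewrite in_itv/= (@lt_le_trans _ _ x) ?zI ?xI'.
have fd z (zI : z \in `[x, r]) := is_deriveB
   (is_deriveZ c (ud z (sub1 z zI))) (is_deriveZ (w x) (is_derive_id z 1)).
have fc := is_derive_within_continuous fd.
have fd' z (zI : z \in `]x, r[) := fd z (subset_itv_oo_cc zI).
have := le_of_derive_ge0 xr fd' fc.
move=> H; have {H} : c * u x - w x * x <= c * u r - w x * r; last lra.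
apply: H => z zI; rewrite subr_ge0.
have xz : x <= z by rewrite (itvP zI).
have sub' y : y \in `[x, z] -> y \in `]l, r[.
  move=> /itvP yI; rewrite in_itv/= (@lt_le_trans _ _ x) ?yI ?xI'//=.
  by rewrite (@le_lt_trans _ _ z) ?(itvP zI) ?yI.
have wd' y (yI : y \in `[x, z]) := wd y (sub' y yI).
have wxz : w x <= w z.
  apply: (le_of_derive_ge0_cc xz wd') => y /sub' yI.
  rewrite -(pmulr_rge0 _ e0) (le_trans _ (ode _ yI))// mulr_ge0// du0//.
rewrite /GRing.scale/= mulr1 (le_trans wxz)//.
by have /andP[] := wB z (sub z zI).
Qed.

(** * The layer of the auxiliary unknown at the origin *)

Lemma is_derive_reflect (R : realType) (f : R -> R) (x a : R) :
  is_derive (- x) 1 f a -> is_derive x 1 (fun y => f (- y)) (- a).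
Proof.
move=> fa; have := @is_derive1_comp R f (-%R) x a (- 1) fa.
rewrite mulrN mulr1; apply.
Qed.

Section layer.
Context (R : realType).
Implicit Types (v dv ddv : R -> R) (kappa delta x : R).

(** [v'] solves a linear equation, hence is positive throughout because [v]
    increases from [-1] to [1]. To the left of [- delta] the equation gives
    [kappa * (v')' >= delta * v'], so that the decay estimate applies with flux
    [v'] and viscosity [kappa]; its left endpoint is then sent to [-oo]. *)
Lemma layer_left v dv ddv kappa delta x : 0 < kappa -> 0 < delta ->
  (forall y : R, is_derive y 1 v (dv y)) ->
  (forall y : R, is_derive y 1 dv (ddv y)) ->
  (forall y : R, - y * dv y = kappa * ddv y) ->
  v y @[y --> -oo] --> (-1 : R) -> v y @[y --> +oo] --> (1 : R) ->
  x <= - (2 * delta) -> `|v x - (-1)| <= 2 * kappa / delta ^+ 2.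
Proof.
move=> k0 d0 vd dvd ode vl vr xd.
(* [v] takes both signs, so the mean value theorem finds [v' > 0] somewhere. *)
have [c dvc] : exists c, 0 < dv c.
  near (ninfty_nbhs R) => a; near (pinfty_nbhs R) => b.
  have ab : a < b by apply: (@lt_trans _ _ 0);
    [near: a; exact: nbhs_ninfty_lt|near: b; exact: nbhs_pinfty_gt].
  have vc := @is_derive_within_continuous R v dv a b (fun y _ => vd y).
  have [c _ E] := MVT ab (fun y _ => vd y) vc.
  exists c; rewrite -(pmulr_lgt0 _ (x := b - a)) ?subr_gt0// -E subr_gt0.
  by apply: (@lt_trans _ _ 0); [near: a; apply: (cvgr_lt _ vl); rewrite oppr_lt0|
    near: b; apply: (cvgr_gt _ vr)].
have dv0 y : 0 < dv y.
  pose N := `|y| + `|c| + 1.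
  have N0 : 0 <= N by rewrite !addr_ge0.
  have inN z : `|z| <= `|y| + `|c| -> z \in `]- N, N[.
    by move=> zN; rewrite in_itv/= -ltr_norml ltr_pwDr.
  apply: (@linear_ode_pos R dv ddv (N / kappa) (- N) N c (fun y _ => dvd y)).
  - move=> z; rewrite in_itv/= -ltr_norml => zN.
    rewrite mulrAC ler_pdivlMr// mulrC -[X in X * _](gtr0_norm k0) -normrM -ode.
    by rewrite normrM normrN ler_wpM2r// ltW.
  - by apply: inN; rewrite lerDr.
  - by [].
  - by apply: inN; rewrite lerDl.
have vnd a b : a <= b -> v a <= v b.
  by move=> ab; apply: (le_of_derive_ge0_cc ab (fun y _ => vd y)) => y _; exact: ltW.
have vge y : -1 <= v y.
  apply: (cvgr_to_le vl); near=> z; apply: vnd; near: z.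
  by apply: nbhs_ninfty_le; exact: num_real.
have vle y : v y <= 1.
  apply: (cvgr_to_ge vr); near=> z; apply: vnd; near: z.
  by apply: nbhs_pinfty_ge; exact: num_real.
have xmd : x < - delta by lra.
have H y : y < x -> delta * (v x - v y) <= kappa * dv x /\
    dv x * (- delta - x) <= 1 * (v (- delta) - v x).
  move=> yx.
  have [|||H1 H2] := @decay_estimate R v dv dv ddv kappa delta 1 (y - 1) (- delta)
    x ltr01 (ltW d0) k0 (fun y _ => vd y) (fun y _ => dvd y).
  - by move=> z _; rewrite mul1r lexx ltW.
  - move=> z /itvP zI; rewrite -ode ler_wpM2r ?(ltW (dv0 _))// lerNr.
    by rewrite zI.
  - by rewrite in_itv/= xmd andbT; lra.
  by split=> //; apply: H1; rewrite in_itv/= (ltW yx) andbT; lra.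
have [|_ H2] := H (x - 1); first by lra.
have vv : v (- delta) - v x <= 2 by have := vle (- delta); have := vge x; lra.
have dvx : dv x * delta <= 2.
  apply: le_trans vv; rewrite mul1r in H2; apply: le_trans H2.
  by rewrite ler_wpM2l ?(ltW (dv0 _))//; lra.
have H1 : delta * (v x - (-1)) <= kappa * dv x.
  have L : delta * (v x - v y) @[y --> -oo] --> delta * (v x - (-1)).
    by apply: cvgM; [exact: cvg_cst|apply: cvgB => //; exact: cvg_cst].
  apply: (cvgr_to_le L); near=> y; have [] // := H y; near: y.
  by apply: nbhs_ninfty_lt; exact: num_real.
rewrite ger0_norm; last by have := vge x; lra.
rewrite ler_pdivlMr ?exprn_gt0// expr2 mulrA mulrC.
rewrite (le_trans _ (_ : kappa * (dv x * delta) <= _))//; last first.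
  by rewrite [leRHS]mulrC ler_wpM2l// ltW.
have := ler_wpM2l (ltW d0) H1; lra.
Unshelve. all: by end_near. Qed.

(** The equation is invariant under [v |-> - v (- x)]. *)
Lemma layer_right v dv ddv kappa delta x : 0 < kappa -> 0 < delta ->
  (forall y : R, is_derive y 1 v (dv y)) ->
  (forall y : R, is_derive y 1 dv (ddv y)) ->
  (forall y : R, - y * dv y = kappa * ddv y) ->
  v y @[y --> -oo] --> (-1 : R) -> v y @[y --> +oo] --> (1 : R) ->
  2 * delta <= x -> `|v x - 1| <= 2 * kappa / delta ^+ 2.
Proof.
move=> k0 d0 vd dvd ode vl vr xd.
have vd' (y : R) : is_derive y 1 (fun y => - v (- y)) (dv (- y)).
  by rewrite -[dv _]opprK; exact: (is_deriveN (is_derive_reflect (vd _))).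
have dvd' (y : R) := is_derive_reflect (dvd (- y)).
have -> : v x - 1 = - (- v (- - x) - (-1)) by rewrite opprK; lra.
rewrite normrN; apply: (layer_left k0 d0 vd' dvd').
- by move=> y; have := ode (- y); lra.
- apply: cvgN; exact/cvgy_compNP.
- rewrite -[X in _ --> X]opprK; apply: cvgN; exact/cvgNy_compNP.
- by rewrite lerN2.
Qed.
End layer.

(** * Differentiable convex functions *)

(** Compactness in the first variable makes continuity in the second one
    uniform. It serves both for the coefficients as [v] approaches [-1] or [1]
    and, with [F (a, b) = eta' (a + b)], for the difference quotients of
    [eta]. *)
Lemma continuous_unif_compact (R : realType) (F : R * R -> R) (K : set R) (b0 e : R) :
  continuous F -> compact K -> 0 < e ->
  \forall b \near b0, forall a, K a -> `|F (a, b) - F (a, b0)| < e.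
Proof.
move=> cF /compact_near_coveringP cK e0.
apply: (cK R (nbhs b0) (fun b a => `|F (a, b) - F (a, b0)| < e) _) => x Kx.
have e20 : 0 < e / 2 by rewrite divr_gt0.
have /cvgrPdist_lt /(_ _ e20) [[U V] /= [Ux Vb] UV] := cF (x, b0).
exists (U, V) => //= -[a b] /= [Ua Vb'].
have h1 : `|F (x, b0) - F (a, b)| < e / 2 by apply: (UV (a, b)).
have h2 : `|F (x, b0) - F (a, b0)| < e / 2.
  by apply: (UV (a, b0)); split => //=; exact: nbhs_singleton.
rewrite (splitr e) (_ : _ - _ = (F (x, b0) - F (a, b0)) - (F (x, b0) - F (a, b))); last by ring.
by rewrite (le_lt_trans (ler_normB _ _))// ltrD.
Qed.

(** The chord bounds [eta] from above on the segment from [x] to [y]; comparing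
    the derivatives of the two at [x] gives the inequality, in whichever
    direction [y] lies. *)
Lemma convex_tangent_le (R : realType) (eta : R -> R) (x y : R) :
  convex_function [set: R] eta -> (forall z : R, derivable eta z 1) ->
  derive1 eta x * (y - x) <= eta y - eta x.
Proof.
move=> ec ed.
pose psi t := t * (eta y - eta x) - (eta (x + t * (y - x)) - eta x).
have dpsi : is_derive (0 : R) (1 : R) psi
    ((eta y - eta x) - derive1 eta x * (y - x)).
  have de : is_derive (x + 0 * (y - x)) 1 eta (derive1 eta x).
    by rewrite mul0r addr0 derive1E; exact/derivableP.
  have dl : is_derive (0 : R) (1 : R) (fun t => x + t * (y - x)) (y - x).
    by apply: is_derive_eq; rewrite /GRing.scale/=; ring.
  have dc : is_derive (0 : R) (1 : R) (fun t => eta (x + t * (y - x)))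
      (derive1 eta x * (y - x)).
    exact: (@is_derive1_comp R eta (fun t => x + t * (y - x)) 0 _ _ de dl).
  have dl' : is_derive (0 : R) (1 : R) (fun t => t * (eta y - eta x)) (eta y - eta x).
    by apply: is_derive_eq; rewrite /GRing.scale/=; ring.
  have dp := is_deriveB dl' (is_deriveB dc (is_derive_cst (eta x) (0 : R) (1 : R))).
  by rewrite subr0 in dp.
rewrite -subr_ge0.
have [] := dpsi; rewrite /derivable => H E; rewrite -E /derive in H *.
have {}H := cvg_dnbhs_at_right H.
apply: (cvgr_to_ge H); near=> t.
have t0 : 0 < t by near: t; exact: nbhs_right_gt.
have t1 : t <= 1 by near: t; exact: nbhs_right_le.
rewrite /= /GRing.scale/= mulr_ge0 ?invr_ge0 ?(ltW t0)// /psi/= addr0 mulr1.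
rewrite !mul0r addr0 subrr subr0 subr0.
have : eta (t * y + (1 - t) * x) <= t * eta y + (1 - t) * eta x.
  exact: (ec (Itv01 (ltW t0) t1) y x (in_setT _) (in_setT _)).
rewrite (_ : t * y + (1 - t) * x = x + t * (y - x)); last by ring.
by lra.
Unshelve. all: by end_near. Qed.

Section convex_derivative.
Context (R : realType) (eta : R -> R).
Context (ec : convex_function [set: R] eta)
  (ed : forall z : R, derivable eta z 1).

Lemma convex_derive1_homo (x y : R) : x <= y -> derive1 eta x <= derive1 eta y.
Proof.
rewrite le_eqVlt => /predU1P[->//|xy].
have := convex_tangent_le x y ec ed; have := convex_tangent_le y x ec ed.
move=> h1 h2; rewrite -(ler_pM2r (x := y - x)) ?subr_gt0//; lra.
Qed.

(** For a fixed small [h], tangent inequalities squeeze [eta' y] between the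
    difference quotients of [eta] at [y] with increments [- h] and [h]. These are
    continuous in [y], and close to [eta' x] when [y = x]. *)
Lemma convex_derive1_continuous : continuous (derive1 eta).
Proof.
have etac := is_derive_continuousT (fun z => is_derive_derive1 (@ed z)).
move=> x; apply/cvgrPdist_le => e e0; have e20 : 0 < e / 2 by rewrite divr_gt0.
have /cvgrPdist_lt /(_ _ e20) [r /= r0 quot] : (h^-1 *: (eta (h + x) - eta x)) @[h --> (0 : R)^'] --> derive1 eta x.
  have := @ed x; rewrite /derivable; under eq_fun do rewrite /= [_%:A]mulr1.
  by move=> /cvgP.
pose h := r / 2.
have h0 : 0 < h by rewrite divr_gt0.
have hr : `|h| < r by rewrite gtr0_norm// /h; lra.
have qp : `|derive1 eta x - h^-1 * (eta (h + x) - eta x)| < e / 2.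
  by apply: (quot h); rewrite /= ?gt_eqF// sub0r normrN.
have qm : `|derive1 eta x - (- h)^-1 * (eta (- h + x) - eta x)| < e / 2.
  by apply: (quot (- h)); rewrite /= ?lt_eqF ?oppr_lt0// sub0r normrN normrN.
have cq k : h^-1 * (eta (k + y) - eta y) @[y --> x] --> h^-1 * (eta (k + x) - eta x).
  apply: cvgM; first exact: cvg_cst.
  apply: cvgB; last exact: etac.
  apply: (@continuous_comp _ _ _ (fun y => k + y) eta); last exact: etac.
  by apply: cvgD; [exact: cvg_cst|exact: cvg_id].
have /cvgrPdist_lt /(_ _ e20) cp := cq h.
have /cvgrPdist_lt /(_ _ e20) cm := cq (- h).
near=> y.
have cp1 : `|h^-1 * (eta (h + x) - eta x) - h^-1 * (eta (h + y) - eta y)| < e / 2.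
  by near: y; exact: cp.
have cm1 : `|h^-1 * (eta (- h + x) - eta x) - h^-1 * (eta (- h + y) - eta y)| < e / 2.
  by near: y; exact: cm.
have tp : derive1 eta y <= h^-1 * (eta (h + y) - eta y).
  rewrite mulrC ler_pdivlMr//; have := convex_tangent_le y (h + y) ec ed.
  by rewrite addrK.
have tm : - derive1 eta y <= h^-1 * (eta (- h + y) - eta y).
  rewrite mulrC ler_pdivlMr//; have := convex_tangent_le y (- h + y) ec ed.
  by rewrite addrK mulrN mulNr.
move: qm; rewrite invrN mulNr opprK => qm.
move: qp qm cp1 cm1; rewrite !ltr_norml ler_norml => /andP[? ?] /andP[? ?] /andP[? ?] /andP[? ?].
by apply/andP; split; lra.
Unshelve. all: by end_near. Qed.

(** The forward difference quotients of [eta] are differentiable substitutes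
    for its derivative: they are nondecreasing because [eta'] is, and the
    quotient at [y] with increment [h] lies between [eta' y] and
    [eta' (y + h)]. *)
Lemma convex_derive1_approx (A B e : R) : 0 < e -> exists g dg : R -> R,
  [/\ forall y : R, is_derive y 1 g (dg y), forall y, 0 <= dg y &
      forall y, y \in `[A, B] -> `|derive1 eta y - g y| <= e].
Proof.
move=> e0.
have cF : continuous (fun z : R * R => derive1 eta (z.1 + z.2)).
  move=> z; apply: (@continuous_comp _ _ _ (fun z : R * R => z.1 + z.2) (derive1 eta)).
    by apply: cvgD; [exact: cvg_fst|exact: cvg_snd].
  exact: convex_derive1_continuous.
have [r /= r0 H] := continuous_unif_compact 0 cF (@segment_compact _ A B) e0.
pose h := r / 2.
have h0 : 0 < h by rewrite divr_gt0.
have hr : `|h| < r by rewrite gtr0_norm// /h; lra.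
exists (fun y => h^-1 * (eta (h + y) - eta y)).
exists (fun y => h^-1 * (derive1 eta (h + y) - derive1 eta y)); split.
- move=> y.
  have de z := is_derive_derive1 (@ed z).
  have dl : is_derive y 1 (fun y : R => h + y) 1.
    by have := is_deriveD (is_derive_cst h y (1 : R)) (is_derive_id y (1 : R)); rewrite add0r.
  have dc := @is_derive1_comp R eta (fun y => h + y) y _ _ (de (h + y)) dl.
  rewrite mulr1 in dc.
  exact: (is_deriveZ h^-1 (is_deriveB dc (de y))).
- move=> y; rewrite mulr_ge0 ?invr_ge0 ?(ltW h0)// subr_ge0 convex_derive1_homo//.
  by rewrite lerDr ltW.
- move=> y yAB; have := H h _ y yAB.
  rewrite /= sub0r normrN addr0 => /(_ hr).
  rewrite (addrC y) ltr_norml => /andP[_ lt_e].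
  have tp : derive1 eta y <= h^-1 * (eta (h + y) - eta y).
    rewrite mulrC ler_pdivlMr//; have := convex_tangent_le y (h + y) ec ed.
    by rewrite addrK.
  have tm : h^-1 * (eta (h + y) - eta y) <= derive1 eta (h + y).
    rewrite mulrC ler_pdivrMr//; have := convex_tangent_le (h + y) y ec ed.
    by rewrite opprD addrA addrAC subrr sub0r; lra.
  by rewrite ler_norml; apply/andP; split; lra.
Qed.
End convex_derivative.

(** * Helly's selection theorem *)

Section helly.
Context (R : realType).
Implicit Types (f : nat -> R -> R) (g : R -> R).

(** Along an ultrafilter every bounded sequence converges, so a single
    ultrafilter on the indices yields a candidate limit at all points at once,
    before any subsequence is chosen. The countable set on which a subsequence
    must converge can thus be chosen depending on that limit. *)
Lemma ultrafilter_pointwise_limit f (C : R) (U : set_system nat) :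
  UltraFilter U -> (forall n x, `|f n x| <= C) ->
  exists g, forall x e, 0 < e -> U [set n | `|f n x - g x| < e].
Proof.
move=> UU fC; suff : forall x, exists p : R, forall e, 0 < e -> U [set n | `|f n x - p| < e].
  by move=> /choice[g gP]; exists g.
move=> x; have cK := @segment_compact R (- C) C.
have [|p [_ clp]] := cK ((f ^~ x) @ U) _.
  by apply: (@filterS _ U) (@filterT _ U _) => n _ /=; rewrite in_itv/= -ler_norml.
exists p => e e0; have [//|Uc] := in_ultra_setVsetC [set n | `|f n x - p| < e] UU.
have [||y [/= ye pye]] := clp [set y | ~ `|y - p| < e] [set y | `|p - y| < e].
- exact: Uc.
- by apply/nbhs_ballP; exists e.
by exfalso; apply: ye; rewrite distrC.
Qed.

(** The [n]-th index is chosen to be good for the first [n] points of [d]: the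
    sets of good indices belong to [U], hence so do their finite
    intersections. *)
Lemma diagonal_subsequence f g (d : nat -> R) (U : set_system nat) :
  ProperFilter U -> \oo `<=` U ->
  (forall x e, 0 < e -> U [set n | `|f n x - g x| < e]) ->
  exists s : nat -> nat, increasing_seq s /\
    forall i, f (s n) (d i) @[n --> \oo] --> g (d i).
Proof.
move=> UP Uoo fg.
have Ufin k e : 0 < e -> U [set n | forall i, (i < k)%N -> `|f n (d i) - g (d i)| < e].
  move=> e0; elim: k => [|k IH]; first by apply: filterS filterT.
  apply: filterS (filterI IH (fg (d k) e e0)) => n /= [h1 h2] i.
  by rewrite ltnS leq_eqVlt => /predU1P[->//|/h1].
have /choice[pick pickP] (kN : nat * nat) : exists n, (kN.2 < n)%N /\
    forall i, (i < kN.1)%N -> `|f n (d i) - g (d i)| < kN.1.+1%:R^-1.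
  have /Uoo UN : \oo [set n | (kN.2 < n)%N] by exists kN.2.+1.
  have e0 : 0 < kN.1.+1%:R^-1 :> R by rewrite invr_gt0.
  by have [n [/= h1 h2]] := filter_ex (filterI UN (Ufin kN.1 _ e0)); exists n.
pose s := fix s k := if k is k'.+1 then pick (k, s k') else pick (0%N, 0%N).
exists s; split.
  by apply/increasing_seqP => n; have [] := pickP (n.+1, s n).
have sP n i : (i < n)%N -> `|f (s n) (d i) - g (d i)| < n.+1%:R^-1.
  by case: n => // n h; have [_] := pickP (n.+1, s n); exact.
move=> i; apply/cvgrPdist_lt => e e0; near=> n.
have sn : `|f (s n) (d i) - g (d i)| < n.+1%:R^-1.
  by apply: sP; near: n; exact: nbhs_infty_gt.
rewrite distrC (lt_trans sn)//; near: n; exact: near_infty_natSinv_lt (PosNum e0).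
Unshelve. all: by end_near. Qed.

(** A rational [r] strictly inside a jump of the nondecreasing [g] at [x]
    determines [x] as the supremum of the sublevel set of [r]; the countably
    many such suprema therefore contain every jump. *)
Lemma nondecreasing_jump_seq g : nondecreasing_fun g -> exists d : nat -> R,
  (forall q : rat, exists i, d i = ratr q) /\
  (forall x, (forall i, d i != x) -> forall e, 0 < e ->
     exists a b, [/\ a < x, x < b & g b - g a < e]).
Proof.
move=> gnd.
pose tau (q : rat) : R := sup [set y | g y <= ratr q].
pose d (n : nat) : R := if unpickle n is Some z then
  match z with inl q => ratr q | inr q => tau q end else 0.
exists d; split=> [q|x dx e e0].
  by exists (pickle (inl q : rat + rat)); rewrite /d pickleK.
(* Otherwise [g] jumps by at least [e] at [x], and a rational [q] fits strictly
   inside the jump. *)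
apply: contrapT => H.
have gap a b : a < x -> x < b -> g a + e <= g b.
  move=> ax xb; rewrite leNgt; apply/negP => h; apply: H; exists a, b.
  by split=> //; rewrite ltrBlDl.
have ax : x - 1 < x by rewrite gtrBl.
have xb : x < x + 1 by rewrite ltrDl.
pose L := sup [set g a | a in [set a | a < x]].
have supL : has_sup [set g a | a in [set a | a < x]].
  split; first by exists (g (x - 1)), (x - 1).
  by exists (g (x + 1)) => _ [a /= ax' <-]; apply: gnd; rewrite ltW// (lt_trans ax').
have gL a : a < x -> g a <= L by move=> ?; apply: sup_upper_bound => //; exists a.
have Lg b : x < b -> L + e <= g b.
  move=> xb'; rewrite -lerBrDr; apply: sup_le_ub; first by case: supL.
  by move=> _ [a /= ax' <-]; rewrite lerBrDr; exact: gap.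
have [q /andP[Lq qLe]] : exists q : rat, L < ratr q < L + e.
  by have [q] := @rat_in_itvoo R L (L + e) (ltac:(by rewrite ltrDl)); rewrite in_itv/=; exists q.
have ub b : x < b -> ubound [set y | g y <= ratr q] b.
  move=> xb' y /= gy; rewrite leNgt; apply/negP => yb.
  have := Lg b xb'; have := gnd _ _ (ltW yb).
  lra.
have ge a : a < x -> a <= tau q.
  move=> ax'; apply: sup_upper_bound.
    by split; [exists (x - 1) => /=; have := gL _ ax; lra|exists (x + 1); exact: ub].
  by rewrite /=; have := gL _ ax'; lra.
suff : tau q = x.
  move=> tx; have := dx (pickle (inr q : rat + rat)).
  by rewrite /d pickleK tx eqxx.
apply/eqP; rewrite eq_le; apply/andP; split.
  apply/ler_addgt0Pr => r r0; apply: sup_le_ub.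
    by exists (x - 1) => /=; have := gL _ ax; lra.
  by apply: ub; rewrite ltrDl.
apply/ler_addgt0Pr => r r0; rewrite -lerBlDr; apply: ge.
by rewrite gtrBl.
Qed.

(** At a point that is not a jump of the limit, monotonicity squeezes the
    subsequence between its values at two rationals, where it converges. *)
Theorem helly_selection f (C : R) :
  (forall n, nondecreasing_fun (f n)) -> (forall n x, `|f n x| <= C) ->
  exists s g, [/\ increasing_seq s, nondecreasing_fun g &
    forall x, f (s n) x @[n --> \oo] --> g x].
Proof.
move=> fnd fC.
have [U [UU Uoo]] := @ultraFilterLemma nat \oo _.
have [g gP] := ultrafilter_pointwise_limit UU fC.
have gnd : nondecreasing_fun g.
  move=> x y xy; apply/ler_addgt0Pr => e e0.
  have e20 : 0 < e / 2 by rewrite divr_gt0.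
  have [n [/= h1 h2]] := filter_ex (filterI (gP x _ e20) (gP y _ e20)).
  have := fnd n _ _ xy; move: h1 h2; rewrite !ltr_norml => /andP[? ?] /andP[? ?]; lra.
have [d [drat djump]] := nondecreasing_jump_seq gnd.
have [s [sinc sd]] := diagonal_subsequence d ultra_proper Uoo gP.
exists s, g; split=> // x.
have [[i <-]|nd] := pselect (exists i, d i = x); first exact: sd.
have ndx i : d i != x by apply/eqP => dx; apply: nd; exists i.
apply/cvgrPdist_lt => e e0; have e20 : 0 < e / 2 by rewrite divr_gt0.
have [a [b [ax xb gab]]] := djump x ndx _ e20.
have [qa] := rat_in_itvoo ax; rewrite in_itv/= => /andP[aqa qax].
have [qb] := rat_in_itvoo xb; rewrite in_itv/= => /andP[xqb qbb].
have [ia ia_] := drat qa; have [ib ib_] := drat qb.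
have /cvgrPdist_lt /(_ _ e20) ca := sd ia.
have /cvgrPdist_lt /(_ _ e20) cb := sd ib.
near=> n.
have : `|g (d ia) - f (s n) (d ia)| < e / 2 by near: n; exact: ca.
have : `|g (d ib) - f (s n) (d ib)| < e / 2 by near: n; exact: cb.
rewrite ia_ ib_ !ltr_norml => /andP[? ?] /andP[? ?].
have := gnd _ _ (ltW aqa); have := gnd _ _ (ltW qax); have := gnd _ _ (ltW xqb).
have := gnd _ _ (ltW qbb); have := fnd (s n) _ _ (ltW qax).
have := fnd (s n) _ _ (ltW xqb).
by move=> *; apply/andP; split; lra.
Unshelve. all: by end_near. Qed.
End helly.

(** * Entropy balance of one viscous profile *)

Section balance.
Context (R : realType) (a b s eps c d K X G P kap : R).
Context (u du w dw a0 a1 phi dphi E Q g k dk A B : R -> R).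
Let mu := @lebesgue_measure R.

Let I x := E (u x) * (phi x + x * dphi x) - Q (u x) * dphi x.
Let T x := x * phi x * E (u x) - Q (u x) * phi x + eps * k (u x) * w x * phi x.
Let C := P * G * d * (X + 1) + kap * K * P + eps * G * P * c.

(** Integrating by parts would require [w'] to be integrable. Instead the
    function [T x + C * s * u x - \int_a^x I] is shown to be nondecreasing by
    differentiating it. In its derivative, [I] cancels the terms in which [E]
    and [Q] are not differentiated, the equation replaces [eps * w'], and
    [C * s * u'] absorbs every term without a sign.

    [k] is the multiplier actually used for the viscous term; it may differ by
    [kap] from [g = eta' \o gamma], which generates [E] and [Q]. The hypothesis
    [0 <= dk (u x) * phi x] covers both a nondecreasing [k] with [0 <= phi] and a
    constant [k] with [phi] of any sign. *)
Lemma entropy_balance : a < b -> s * s = 1 -> 0 < eps ->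
  (forall x : R, x \in `[a, b] -> is_derive x 1 u (du x)) ->
  (forall x : R, x \in `[a, b] -> is_derive x 1 w (dw x)) ->
  (forall x : R, x \in `[a, b] -> 0 <= s * w x <= c * (s * du x)) ->
  (forall x : R, x \in `[a, b] -> 0 <= s * du x) ->
  (forall x : R, x \in `[a, b] -> eps * dw x = (- x * a0 x + a1 x) * du x) ->
  (forall x : R, is_derive x 1 phi (dphi x)) -> continuous dphi ->
  (forall y : R, is_derive y 1 E (g y * A y)) ->
  (forall y : R, is_derive y 1 Q (g y * B y)) ->
  (forall y : R, is_derive y 1 k (dk y)) ->
  (forall x, x \in `[a, b] -> 0 <= dk (u x) * phi x) ->
  (forall x, x \in `[a, b] -> `|A (u x) - a0 x| <= d) ->
  (forall x, x \in `[a, b] -> `|B (u x) - a1 x| <= d) ->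
  (forall x, x \in `[a, b] -> `|- x * a0 x + a1 x| <= K) ->
  (forall x, x \in `[a, b] -> `|x| <= X) ->
  (forall x, x \in `[a, b] -> `|g (u x)| <= G) ->
  (forall x, x \in `[a, b] -> `|k (u x)| <= G) ->
  (forall x, x \in `[a, b] -> `|g (u x) - k (u x)| <= kap) ->
  (forall x, x \in `[a, b] -> `|phi x| <= P) ->
  (forall x, x \in `[a, b] -> `|dphi x| <= P) ->
  \int[mu]_(x in `[a, b]) I x <= T b - T a + C * (s * u b - s * u a).
Proof.
move=> ab s1 e0 ud wd wB du0 ode phid dphic Ed Qd kd dk0 Aa Bb KB XB gB kB gk phiB dphiB.
have Ic (x : R) : x \in `[a, b] -> {for x, continuous I}.
  move=> xI; have uc := is_derive_continuous (ud x xI).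
  apply: cvgB; apply: cvgM.
  - exact: (continuous_comp uc (is_derive_continuous (Ed (u x)))).

  - by apply: cvgD; [exact: (is_derive_continuous (phid x))|apply: cvgM; [exact: cvg_id|exact: dphic]].
  - exact: (continuous_comp uc (is_derive_continuous (Qd (u x)))).
  - exact: dphic.
have Iw : {within `[a, b], continuous I}.
  by apply: continuous_in_subspaceT => x /set_mem; exact: Ic.
have Ii : mu.-integrable `[a, b] (EFin \o I).
  by apply: continuous_compact_integrable => //; exact: segment_compact.
pose J x := (\int[mu]_(t in `[a, x]) I t)%R.
have Jd (x : R) : x \in `]a, b[ -> is_derive x 1 J (I x).
  move=> xI; have /itvP xI' := xI.
  have ax : a < x by rewrite xI'.
  have xb : x < b by rewrite xI'.
  have [Jd JE] := continuous_FTC1_closed xb Ii ax (Ic x (subset_itv_oo_cc xI)).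
  by split => //; rewrite -derive1E.
have Jc : {within `[a, b], continuous J}.
  exact: (parameterized_integral_continuous (ltW ab) Ii).
pose F0 x := T x + C * (s * u x).
pose dF0 x := E (u x) * (phi x + x * dphi x) - Q (u x) * dphi x
  + x * phi x * (g (u x) * A (u x) * du x) - g (u x) * B (u x) * du x * phi x
  + eps * (dk (u x) * du x) * w x * phi x
  + eps * k (u x) * dw x * phi x + eps * k (u x) * w x * dphi x
  + C * (s * du x).
have F0d (x : R) : x \in `[a, b] -> is_derive x 1 F0 (dF0 x).
  move=> xI; have ? := ud x xI; have ? := wd x xI; have ? := phid x.
  have ? := is_derive1_comp (Ed (u x)) (ud x xI).
  have ? := is_derive1_comp (Qd (u x)) (ud x xI).
  have ? := is_derive1_comp (kd (u x)) (ud x xI).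
  rewrite /F0 /T.
  have -> : (fun x => x * phi x * E (u x) - Q (u x) * phi x
    + eps * k (u x) * w x * phi x + C * (s * u x)) =
    (fun x => x * phi x * (E \o u) x - (Q \o u) x * phi x
    + eps * (k \o u) x * w x * phi x + C * (s * u x)) by [].
  apply: is_derive_eq; rewrite /dF0 /GRing.scale/=; ring.
have F0c := is_derive_within_continuous F0d.
pose F x := F0 x - J x.
have Fd (x : R) : x \in `]a, b[ -> is_derive x 1 F (dF0 x - I x).
  by move=> xI; exact: (is_deriveB (F0d x (subset_itv_oo_cc xI)) (Jd x xI)).
have Fc : {within `[a, b], continuous F}.
  by move=> x; apply: continuousB; [exact: F0c|exact: Jc].
have := le_of_derive_ge0 (ltW ab) Fd Fc.
have Ja : J a = 0 by rewrite /J set_itv1 Rintegral_set1.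
suff dF (x : R) : x \in `]a, b[ -> 0 <= dF0 x - I x.
  move=> /(_ dF); rewrite /F Ja -/(J b) /F0; lra.
move=> /subset_itv_oo_cc xI.
(* [p] is the absolute value of [u'], and [w] has the same sign [s]. *)
set p := s * du x; have p0 : 0 <= p := du0 x xI.
have dup : du x = s * p by rewrite /p mulrA s1 mul1r.
have [sw0 swc] := andP (wB x xI).
have sn := normr_sqr1 s1.
have wn : `|w x| <= c * p.
  by have := swc; rewrite -[X in X <= _](ger0_norm sw0) normrM sn mul1r.
have dun : `|du x| = p by rewrite dup normrM sn mul1r ger0_norm.
have -> : dF0 x - I x = phi x * ((k (u x) - g (u x)) * (- x * a0 x + a1 x)
     + g (u x) * (x * (A (u x) - a0 x) - (B (u x) - a1 x))) * du x
   + eps * (dk (u x) * phi x) * (p * (s * w x))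
   + eps * k (u x) * w x * dphi x + C * p.
  have ssp : s * (s * p) = p by rewrite mulrA s1 mul1r.
  have := ode x xI; rewrite /dF0 /I dup ssp => h.
  have -> : eps * k (u x) * dw x * phi x = k (u x) * phi x * (eps * dw x) by ring.
  rewrite h; ring.
have h1 : `|phi x * ((k (u x) - g (u x)) * (- x * a0 x + a1 x)
     + g (u x) * (x * (A (u x) - a0 x) - (B (u x) - a1 x))) * du x|
     <= P * (kap * K + G * (X * d + d)) * p.
  rewrite normrM dun ler_wpM2r// normrM ler_pM ?phiB//.
  rewrite (le_trans (ler_normD _ _))// lerD//.
    by rewrite normrM ler_pM ?KB// distrC gk.
  rewrite normrM ler_pM ?gB// (le_trans (ler_normB _ _))// lerD ?Bb//.
  by rewrite normrM ler_pM ?XB// Aa.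
have h2 : `|eps * k (u x) * w x * dphi x| <= eps * G * (c * p) * P.
  rewrite normrM ler_pM ?dphiB// normrM ler_pM// normrM ler_pM ?kB// gtr0_norm//.
have h3 : 0 <= eps * (dk (u x) * phi x) * (p * (s * w x)).
  by apply: mulr_ge0; apply: mulr_ge0 => //; [exact: ltW|exact: dk0].
have hC : C * p = P * (kap * K + G * (X * d + d)) * p + eps * G * (c * p) * P.
  by rewrite /C; ring.
move: h1 h2; rewrite hC !ler_norml => /andP[h1 _] /andP[h2 _]; lra.
Qed.
End balance.

(** * Bounded convergence on a segment *)

Lemma continuous_compact_bound (R : realType) (T : topologicalType) (f : T -> R) (K : set T) :
  compact K -> {within K, continuous f} ->
  exists2 P, 0 <= P & forall x, K x -> `|f x| <= P.
Proof.
move=> cK fK; have /compact_bounded[N [_ NP]] := continuous_compact fK cK.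
exists (`|N| + 1); first by rewrite addr_ge0.
by move=> x Kx; apply: (NP (`|N| + 1)); [rewrite ltr_pwDr// ler_norm|exists x].
Qed.

Lemma bounded_cvg_Rintegral (R : realType) (a b C : R) (f : nat -> R -> R) (f0 : R -> R) :
  (forall n, {within `[a, b], continuous (f n)}) ->
  (forall n x, x \in `[a, b] -> `|f n x| <= C) ->
  (forall x, x \in `[a, b] -> f n x @[n --> \oo] --> f0 x) ->
  \int[@lebesgue_measure R]_(x in `[a, b]) f n x @[n --> \oo] -->
  \int[@lebesgue_measure R]_(x in `[a, b]) f0 x.
Proof.
move=> fc fC ff0; set mu := @lebesgue_measure R.
have cK := @segment_compact R a b.
have mf n := measurable_int mu (continuous_compact_integrable cK (fc n)).
have cv x : `[a, b]%classic x -> (f n x)%:E @[n --> \oo] --> (f0 x)%:E.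
  by move=> xab; apply: cvg_EFin; [exact: nearW|exact: ff0].
have mf0 := measurable_realfun.emeasurable_fun_cvg _ _ mf cv.
have ci : mu.-integrable `[a, b] (EFin \o fun=> C).
  by apply: continuous_compact_integrable => // x; exact: cvg_cst.
have cvae := aeW mu cv.
have bdae : {ae mu, forall x n, `[a, b]%classic x -> (`|(f n x)%:E| <= C%:E)%E}.
  by apply: aeW => x n xab /=; rewrite lee_fin; exact: fC.
have [i0 _ ic] := @dominated_convergence _ _ R mu _ (measurable_itv `[a, b])
  (fun n => EFin \o f n) (EFin \o f0) (EFin \o fun=> C) mf mf0 cvae ci bdae.
apply: fine_cvg; rewrite /Rintegral fineK//.
exact: integrable_fin_num.
Qed.

(** * Vanishing viscosity limit of the entropy balance *)

(** What the limit retains of a sequence of viscous profiles on [`]l, r[]: [a0]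
    and [a1] are the coefficients along the profile, [w] is the viscous flux,
    and [s] is the common direction of monotonicity. *)
Record viscous_family (R : realType) (l r s c K ml mr : R) (eps : nat -> R)
    (u du w dw a0 a1 : nat -> R -> R) : Prop := ViscousFamily {
  vf_eps_gt0 : forall n, 0 < eps n ;
  vf_sign : s * s = 1 ;
  vf_c_ge0 : 0 <= c ;
  vf_u_derive : forall n (x : R), x \in `]l, r[ -> is_derive x 1 (u n) (du n x) ;
  vf_w_derive : forall n (x : R), x \in `]l, r[ -> is_derive x 1 (w n) (dw n x) ;
  vf_u_mono : forall n x, x \in `]l, r[ -> 0 <= s * du n x ;
  vf_w_bound : forall n x, x \in `]l, r[ -> 0 <= s * w n x <= c * (s * du n x) ;
  vf_u_range : forall n x, x \in `]l, r[ -> u n x \in `[ml, mr] ;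
  vf_ode : forall n x, x \in `]l, r[ ->
    eps n * dw n x = (- x * a0 n x + a1 n x) * du n x ;
  vf_coef_bound : forall n x, x \in `]l, r[ -> `|- x * a0 n x + a1 n x| <= K
}.

(** Differentiable substitutes [k] for the multiplier [g]. The sign condition is
    on the product [dk y * phi x] so that constant multipliers, whose derivative
    vanishes, go with test functions of arbitrary sign. *)
Definition multiplier_approx (R : realType) (ml mr : R) (g phi : R -> R) : Prop :=
  forall kap, 0 < kap -> exists k dk : R -> R,
    [/\ forall y : R, is_derive y 1 k (dk y),
        forall x y, y \in `[ml, mr] -> 0 <= dk y * phi x &
        forall y, y \in `[ml, mr] -> `|g y - k y| <= kap].

Section entropy_limit.
Context (R : realType) (l r s c K ml mr a b : R) (eps : nat -> R).
Context (u du w dw a0 a1 : nat -> R -> R) (u0 phi dphi E Q g A B : R -> R).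
Let mu := @lebesgue_measure R.
Let bd x := x * phi x * E (u0 x) - Q (u0 x) * phi x.

(** For a fixed tolerance [kap] on the multiplier and on the coefficients, the
    right-hand side of the entropy balance converges to [bd b - bd a + kap * N]
    with [N] independent of [kap]; then [kap] tends to 0. The total variation of
    the profiles is at most [mr - ml] by monotonicity, which is what makes the
    constant uniform. *)
Lemma entropy_limit :
  viscous_family l r s c K ml mr eps u du w dw a0 a1 ->
  eps n @[n --> \oo] --> (0 : R) ->
  l < a -> a < b -> b < r ->
  (forall x, x \in `[a, b] -> u n x @[n --> \oo] --> u0 x) ->
  (forall d, 0 < d -> \forall n \near \oo, forall x, x \in `[a, b] ->
     `|A (u n x) - a0 n x| <= d /\ `|B (u n x) - a1 n x| <= d) ->
  (forall x : R, is_derive x 1 phi (dphi x)) -> continuous dphi ->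
  (forall y : R, is_derive y 1 E (g y * A y)) ->
  (forall y : R, is_derive y 1 Q (g y * B y)) ->
  continuous g ->
  multiplier_approx ml mr g phi ->
  eps n * w n a * phi a @[n --> \oo] --> (0 : R) ->
  eps n * w n b * phi b @[n --> \oo] --> (0 : R) ->
  \int[mu]_(x in `[a, b]) (E (u0 x) * (phi x + x * dphi x) - Q (u0 x) * dphi x)
    <= bd b - bd a.
Proof.
move=> [e0 s1 c0 ud wd du0 wB uR ode KB] ecvg la ab br uu0 AB phid dphic Ed Qd gc mult wa wb.
have sub (x : R) : x \in `[a, b] -> x \in `]l, r[.
  move=> /itvP xI; rewrite in_itv/= (@lt_le_trans _ _ a) ?xI//=.
  by rewrite (@le_lt_trans _ _ b) ?xI.
have phic := is_derive_continuousT phid.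
have Ec := is_derive_continuousT Ed.
have Qc := is_derive_continuousT Qd.
have cK := @segment_compact R.
have [P1 P10 phiB] := continuous_compact_bound (cK a b) (continuous_subspaceT phic).
have [P2 P20 dphiB] := continuous_compact_bound (cK a b) (continuous_subspaceT dphic).
have [X X0 XB] := continuous_compact_bound (cK a b) (continuous_subspaceT (fun x : R => @cvg_id _ (nbhs x))).
have [CE CE0 EB] := continuous_compact_bound (cK ml mr) (continuous_subspaceT Ec).
have [CQ CQ0 QB] := continuous_compact_bound (cK ml mr) (continuous_subspaceT Qc).
have [G G0 gB] := continuous_compact_bound (cK ml mr) (continuous_subspaceT gc).
pose P := P1 + P2.
have phiP x : x \in `[a, b] -> `|phi x| <= P.
  by move=> xI; rewrite (le_trans (phiB x xI))// lerDl.
have dphiP x : x \in `[a, b] -> `|dphi x| <= P.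
  by move=> xI; rewrite (le_trans (dphiB x xI))// lerDr.
have P0 : 0 <= P by rewrite addr_ge0.
pose f n x := E (u n x) * (phi x + x * dphi x) - Q (u n x) * dphi x.
pose f0 x := E (u0 x) * (phi x + x * dphi x) - Q (u0 x) * dphi x.
have fc n : {within `[a, b], continuous (f n)}.
  apply: continuous_in_subspaceT => x /set_mem xI.
  have uc := is_derive_continuous (ud n x (sub x xI)).
  apply: cvgB; apply: cvgM.
  - exact: (continuous_comp uc (Ec (u n x))).
  - by apply: cvgD; [exact: phic|apply: cvgM; [exact: cvg_id|exact: dphic]].
  - exact: (continuous_comp uc (Qc (u n x))).
  - exact: dphic.
have fB n x : x \in `[a, b] -> `|f n x| <= CE * (P + X * P) + CQ * P.
  move=> xI; have uI := uR n x (sub x xI).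
  rewrite (le_trans (ler_normB _ _))// lerD// normrM ler_pM ?EB ?QB ?dphiP//.
  by rewrite (le_trans (ler_normD _ _))// lerD ?phiP// normrM ler_pM ?XB ?dphiP.
have ff0 x : x \in `[a, b] -> f n x @[n --> \oo] --> f0 x.
  move=> xI; apply: cvgB; apply: cvgM; try exact: cvg_cst.
  - exact: (continuous_cvg _ (Ec (u0 x)) (uu0 x xI)).
  - exact: (continuous_cvg _ (Qc (u0 x)) (uu0 x xI)).
have intc := bounded_cvg_Rintegral fc fB ff0.
have aI : a \in `[a, b] by rewrite in_itv/= lexx ltW.
have bI : b \in `[a, b] by rewrite in_itv/= lexx ltW.
have aO := sub a aI; have bO := sub b bI.
pose D := mr - ml.
have D0 : 0 <= D by rewrite subr_ge0; have /itvP uI := uR 0%N a aO; rewrite (@le_trans _ _ (u 0%N a)) ?uI.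
have sn := normr_sqr1 s1.
have uD n : s * u n b - s * u n a <= D.
  rewrite -mulrBr (le_trans (ler_norm _))// normrM sn mul1r ler_norml /D.
  have /itvP ua := uR n a aO; have /itvP ub := uR n b bO.
  have ua1 : ml <= u n a by rewrite ua. have ua2 : u n a <= mr by rewrite ua.
  have ub1 : ml <= u n b by rewrite ub. have ub2 : u n b <= mr by rewrite ub.
  by move=> *; apply/andP; split; lra.
pose N := (P * (G + 1) * (X + 1) + K * P) * D.
suff key kap : 0 < kap -> kap <= 1 -> \int[mu]_(x in `[a, b]) f0 x <= bd b - bd a + kap * N.
  have L : bd b - bd a + kap * N @[kap --> (0 : R)^'+] --> bd b - bd a + 0 * N.
    apply: cvgD; first exact: cvg_cst.
    by apply: cvgM; [exact: (cvg_at_right_filter cvg_id)|exact: cvg_cst].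
  rewrite mul0r addr0 in L; apply: (cvgr_to_ge L); near=> kap; apply: key.
    by near: kap; exact: nbhs_right_gt.
  by near: kap; exact: nbhs_right_le.
move=> kap0 kap1; have [k [dk [kd dkphi gk]]] := mult _ kap0.
have kB y : y \in `[ml, mr] -> `|k y| <= G + 1.
  move=> yI; have -> : k y = g y - (g y - k y) by ring.
  by rewrite (le_trans (ler_normB _ _))// lerD ?gB// (le_trans (gk y yI)).
pose T n x := x * phi x * E (u n x) - Q (u n x) * phi x + eps n * k (u n x) * w n x * phi x.
pose C n := P * (G + 1) * kap * (X + 1) + kap * K * P + eps n * (G + 1) * P * c.
have Tcvg x : x \in `[a, b] -> eps n * w n x * phi x @[n --> \oo] --> (0 : R) ->
    T n x @[n --> \oo] --> bd x.
  move=> xI wx; rewrite -[bd x]addr0; apply: cvgD.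
    apply: cvgB; apply: cvgM; try exact: cvg_cst.
    - exact: (continuous_cvg _ (Ec (u0 x)) (uu0 x xI)).
    - exact: (continuous_cvg _ (Qc (u0 x)) (uu0 x xI)).
  have z0 : (G + 1) * `|eps n * w n x * phi x| @[n --> \oo] --> (0 : R).
    by rewrite -[X in _ --> X](mulr0 (G + 1)); apply: cvgM; [exact: cvg_cst|exact/norm_cvg0P].
  apply: norm_cvg0; apply: (squeeze_cvgr _ (cvg_cst 0) z0).
  apply: nearW => n /=; rewrite normr_ge0/=.
  have -> : eps n * k (u n x) * w n x * phi x = k (u n x) * (eps n * w n x * phi x) by ring.
  by rewrite normrM ler_wpM2r// kB// uR// sub.
have Ccvg : T n b - T n a + C n * D @[n --> \oo] --> bd b - bd a + kap * N.
  have -> : kap * N = (P * (G + 1) * kap * (X + 1) + kap * K * P + 0 * (G + 1) * P * c) * D.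
    by rewrite /N; ring.
  apply: cvgD; first by apply: cvgB; exact: Tcvg.
  apply: cvgM; last exact: cvg_cst.
  apply: cvgD; first exact: cvg_cst.
  by do 3 (apply: cvgM; last exact: cvg_cst).
apply: (ler_cvg_to intc Ccvg); near=> n.
have ABn x : x \in `[a, b] -> `|A (u n x) - a0 n x| <= kap /\ `|B (u n x) - a1 n x| <= kap.
  by move: x; near: n; exact: AB.
have G1 : 0 <= G + 1 by rewrite addr_ge0.
have K0 : 0 <= K by rewrite (le_trans _ (KB n a aO)).
have C0 : 0 <= C n.
  by rewrite /C !addr_ge0// !mulr_ge0// ?addr_ge0// ?(ltW kap0)// ?(ltW (e0 n)).
have := @entropy_balance R a b s (eps n) c kap K X (G + 1) P kap (u n) (du n) (w n) (dw n)
  (a0 n) (a1 n) phi dphi E Q g k dk A B ab s1 (e0 n)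
  (fun x xI => ud n x (sub x xI)) (fun x xI => wd n x (sub x xI))
  (fun x xI => wB n x (sub x xI)) (fun x xI => du0 n x (sub x xI))
  (fun x xI => ode n x (sub x xI)) phid dphic Ed Qd kd
  (fun x xI => dkphi x _ (uR n x (sub x xI)))
  (fun x xI => (ABn x xI).1) (fun x xI => (ABn x xI).2)
  (fun x xI => KB n x (sub x xI)) XB.
move=> /(_ _ _ _ phiP dphiP) H; apply: (le_trans (H _ _ _)).
- by move=> x xI; rewrite (le_trans (gB _ (uR n x (sub x xI))))// lerDl.
- by move=> x xI; exact: kB (uR n x (sub x xI)).
- by move=> x xI; exact: gk (uR n x (sub x xI)).
by rewrite lerD2l; apply: ler_wpM2l.
Unshelve. all: by end_near. Qed.
End entropy_limit.

(** * Self-similar distributions as integrals over a segment *)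

Lemma Rintegral_derive (R : realType) (F f : R -> R) (a b : R) : a <= b ->
  (forall x : R, is_derive x 1 F (f x)) -> continuous f ->
  \int[@lebesgue_measure R]_(x in `[a, b]) f x = F b - F a.
Proof.
rewrite le_eqVlt => /predU1P[->|ab] Fd fc.
  by rewrite set_itv1 Rintegral_set1 subrr.
have Fc := is_derive_continuousT Fd.
have dF : derivable_oo_LRcontinuous F a b.
  split; first by move=> x _; have [] := Fd x.
  - exact: cvg_at_right_filter (Fc a).
  - exact: cvg_at_left_filter (Fc b).
rewrite /Rintegral (continuous_FTC2 ab (continuous_subspaceT fc) dF)//.
by move=> x _; rewrite derive1E; have [] := Fd x.
Qed.

Lemma Rintegral_cat (R : realType) (f : R -> R) (a m b : R) : a <= m -> m <= b ->
  (@lebesgue_measure R).-integrable `[a, b] (EFin \o f) ->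
  \int[@lebesgue_measure R]_(x in `[a, b]) f x =
  \int[@lebesgue_measure R]_(x in `[a, m]) f x +
  \int[@lebesgue_measure R]_(x in `[m, b]) f x.
Proof.
move=> am mb fi; have := Rintegral_itvB fi; move=> /(_ m); rewrite !bnd_simp => /(_ am mb) H.
rewrite -(@Rintegral_itv_obnd_cbnd _ m) -?H; first by rewrite addrCA subrr addr0.
by apply: integrableS fi => //; apply: subset_itvr; rewrite bnd_simp.
Qed.

(** Once the test function is confined to a segment, the action of
    [- xi * dw/dxi + dF/dxi] is a single integral over that segment. *)
Lemma selfsimilar_itv (R : realType) (W F phi : R -> R) (a b C : R) : a < b ->
  measurable_fun setT W -> measurable_fun setT F ->
  (forall x, `|W x| <= C) -> (forall x, `|F x| <= C) ->
  (forall x : R, derivable phi x 1) -> continuous (derive1 phi) ->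
  (forall x, x \notin `[a, b] -> phi x = 0 /\ derive1 phi x = 0) ->
  (@lebesgue_measure R).-integrable `[a, b]
    (EFin \o (fun x => W x * (phi x + x * derive1 phi x) - F x * derive1 phi x)) /\
  selfsimilar W F phi =
  \int[@lebesgue_measure R]_(x in `[a, b])
    (W x * (phi x + x * derive1 phi x) - F x * derive1 phi x).
Proof.
move=> ab mW mF WC FC phid dphic phi0; set mu := @lebesgue_measure R.
have phic := is_derive_continuousT (fun x => is_derive_derive1 (phid x)).
have int (V h : R -> R) : measurable_fun setT V -> (forall x, `|V x| <= C) ->
    continuous h -> mu.-integrable `[a, b] (EFin \o (fun x => V x * h x)).
  move=> mV VC hc.
  have [Ch Ch0 hC] := continuous_compact_bound (@segment_compact R a b) (continuous_subspaceT hc).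
  apply: measurable_bounded_integrable => //.
  - exact: compact_finite_measure (@segment_compact R a b).
  - apply: measurable_funM; apply: measurable_funTS => //.
    exact: continuous_measurable_fun.
  - exists (C * Ch); split; first exact: num_real.
    move=> y Cy x /= xI; rewrite (le_trans _ (ltW Cy))// normrM.
    by apply: ler_pM => //; exact: hC.
have hc : continuous (fun x => phi x + x * derive1 phi x).
  move=> x; apply: cvgD; first exact: phic.
  by apply: cvgM; [exact: cvg_id|exact: dphic].
have iW := int W _ mW WC hc.
have iF := int F _ mF FC dphic.
have full (f : R -> R) : (forall x, x \notin `[a, b] -> f x = 0) ->
    \int[mu]_x f x = \int[mu]_(x in `[a, b]) f x.
  move=> f0; rewrite [RHS]Rintegral_mkcond; congr (Rintegral mu setT _).
  apply/funext => x; rewrite patchE; case: ifPn => //.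
  by rewrite notin_setE/= => /negP; exact: f0.
have dxphi x : derive1 (fun x => - x * phi x) x = -1 * (phi x + x * derive1 phi x).
  have dp := is_derive_derive1 (phid x).
  rewrite derive1E; have : is_derive x 1 (fun x : R => - x * phi x) (-1 * (phi x + x * derive1 phi x)).
    by apply: is_derive_eq; rewrite /GRing.scale/=; ring.
  by case.
split; first exact: (@integrableB _ _ _ mu _ (measurable_itv `[a, b]) _ _ iW iF).
rewrite RintegralB// /selfsimilar /ddx; congr (_ + - _); last first.
  by apply: full => x /phi0[_ ->]; rewrite mulr0.
rewrite full; last by move=> x /phi0[h1 h2]; rewrite dxphi h1 h2 mulr0 addr0 !mulr0.
under eq_Rintegral do rewrite dxphi mulrCA.
by rewrite RintegralZl// mulN1r opprK.
Qed.

(** The support is compact and avoids the origin, hence keeps a positive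
    distance from it, out of reach of the shrinking layer of [v]. *)
Lemma test_function_support (R : realType) (D : set R) (phi : R -> R) :
  test_function D phi -> ~ D 0 ->
  exists r N : R, [/\ 0 < r, 0 < N & forall x, phi x != 0 -> D x /\ r <= `|x| <= N].
Proof.
move=> [_ [K [cK KD phi0]]] D0.
have [N [_ KN]] := compact_bounded cK.
have oK : open (~` K) by apply: closed_openC; exact: compact_closed.
have [|r /= r0 rK] := oK 0; first by move=> /KD.
exists r, (`|N| + 1); split=> [//||]; first by rewrite ltr_pwDr.
move=> x phix; have Kx : K x by apply: contrapT => /phi0 h; rewrite h eqxx in phix.
split; first exact: KD.
rewrite (KN _ _ _ Kx) ?ltr_pwDr ?ler_norm// andbT leNgt; apply/negP => xr.
by apply: (rK x) => //=; rewrite sub0r normrN.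
Qed.

Lemma test_function_segment (R : realType) (D : set R) (phi : R -> R) : test_function D phi -> ~ D 0 ->
  exists a b : R, a < b /\ forall x, x \notin `]a, b[ -> phi x = 0.
Proof.
move=> tphi D0; have [r [N [r0 N0 rN]]] := test_function_support tphi D0.
exists (- (N + 1)), (N + 1); split; first lra.
move=> x xN; apply/eqP/negPn/negP => /rN[_ /andP[_ h]]; move/negP: xN; apply.
by rewrite in_itv/= -ltr_norml; lra.
Qed.

(** * Estimates on a viscous solution *)

Section solution.
Context (R : realType) (uL uR p c1 c2 c3 Lambda M eps s K : R).
Context (A0 A1 B0 : R -> R -> R) (u v : R -> R).
Context (c1_gt0 : 0 < c1) (c2_gt0 : 0 < c2) (M_gt0 : 0 < M) (Lambda_ge0 : 0 <= Lambda)
  (A0_ge : forall a b : R, b \in `[-1, 1] -> c1 <= A0 a b)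
  (B0_bounds : forall a b : R, b \in `[-1, 1] -> c2 <= B0 a b <= c3)
  (lam_le : forall a b : R, Omega uL uR a -> b \in `[-1, 1] ->
     `|lam A0 A1 a b| <= Lambda)
  (coef_le : forall a b x : R, Omega uL uR a -> b \in `[-1, 1] -> `|x| <= M ->
     `|- x * A0 a b + A1 a b| <= K)
  (eps_gt0 : 0 < eps) (s_sign : s * s = 1) (s_orient : 0 <= s * (uR - uL)).
Context (uv : viscous_solution uL uR p M A0 A1 B0 eps u v).
Let du : R -> R := derive1 u.
Let w : R -> R := fun z : R => B0 (u z) (v z) * derive1 u z.

Let oc (x : R) : x \in `]- M, M[ -> x \in `[- M, M].
Proof. exact: subset_itv_oo_cc. Qed.

Let absM (x : R) : x \in `[- M, M] -> `|x| <= M.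
Proof. by rewrite in_itv/= ler_norml. Qed.

Lemma B0_upper_gt0 : 0 < c3.
Proof.
have : (0 : R) \in `[-1, 1] by rewrite in_itv/= ler01 lerN10.
by move=> /(B0_bounds 0) /andP[h1 h2]; rewrite (lt_le_trans c2_gt0)// (le_trans h1).
Qed.

Lemma solution_u_derive (x : R) : x \in `]- M, M[ -> is_derive x 1 u (du x).
Proof. by move=> xI; exact: is_derive_derive1 (vs_u_derivable uv xI). Qed.

Lemma solution_w_derive (x : R) : x \in `]- M, M[ -> is_derive x 1 w (derive1 w x).
Proof. by move=> xI; exact: is_derive_derive1 (vs_u_flux_derivable uv xI). Qed.

Lemma solution_B0 (x : R) : x \in `]- M, M[ -> c2 <= B0 (u x) (v x) <= c3.
Proof. by move=> xI; apply/B0_bounds/(vs_v_range uv)/oc. Qed.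

(** Were [s * u'] negative at one point, [- s * w] would be positive everywhere,
    and [u] would run against the direction from [uL] to [uR] given by the
    boundary values. *)
Lemma solution_orient (x : R) : x \in `]- M, M[ -> 0 <= s * du x.
Proof.
move=> xI; rewrite leNgt; apply/negP => sdu.
have wd y (yI : y \in `]- M, M[) := is_deriveZ (- s) (solution_w_derive yI).
have B0_gt0 (y : R) : y \in `]- M, M[ -> 0 < B0 (u y) (v y).
  by move=> /solution_B0 /andP[h _]; exact: lt_le_trans h.
have wpos (y : R) : y \in `]- M, M[ -> 0 < - s * w y -> s * du y < 0.
  move=> yI; rewrite /w mulrCA pmulr_rgt0 ?B0_gt0// mulNr oppr_gt0//.
have wlin (y : R) : y \in `]- M, M[ ->
    `|- s * derive1 w y| <= K / (eps * c2) * `|- s * w y|.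
  move=> yI; have yc := oc yI.
  rewrite !normrM mulrCA ler_wpM2l//.
  have ode := vs_u_ode uv yI; rewrite -/w in ode.
  have -> : derive1 w y = eps^-1 * ((- y * A0 (u y) (v y) + A1 (u y) (v y)) * du y).
    by rewrite /du ode mulKf// gt_eqF.
  have /andP[B1 _] := solution_B0 yI.
  have hw : c2 * `|du y| <= `|w y|.
    by rewrite /w normrM ler_wpM2r// (le_trans B1)// ler_norm.
  have hK := coef_le (vs_u_range uv yc) (vs_v_range uv yc) (absM yc).
  have K0 : 0 <= K := le_trans (normr_ge0 _) hK.
  apply: (@le_trans _ _ (K / (eps * c2) * (c2 * `|du y|))).
    rewrite !normrM gtr0_norm ?invr_gt0//.
    have -> : K / (eps * c2) * (c2 * `|du y|) = eps^-1 * (K * `|du y|).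
      by field; rewrite !gt_eqF.
    by rewrite ler_wpM2l ?invr_ge0 ?(ltW eps_gt0)// ler_wpM2r.
  apply: ler_wpM2l; last by move: hw; rewrite /w normrM.
  by rewrite divr_ge0// mulr_ge0// ltW.
have w0 : 0 < - s * w x.
  by rewrite /w mulrCA pmulr_rgt0 ?B0_gt0// mulNr oppr_gt0.
have allpos := linear_ode_pos wd wlin xI w0.
have MM : - M < M by rewrite gtrN.
have [c cI] := MVT MM solution_u_derive (vs_u_cont uv).
rewrite (vs_u_left uv) (vs_u_right uv) => E.
have := wpos c cI (allpos c cI); rewrite ltNge => /negP; apply.
have : 0 <= s * du c * (M - - M) by rewrite -mulrA -E.
by rewrite pmulr_lge0// opprK addr_gt0.
Qed.

Lemma solution_w_bound (x : R) : x \in `]- M, M[ ->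
  0 <= s * w x <= c3 * (s * du x).
Proof.
move=> xI; have /andP[h1 h2] := solution_B0 xI; have du0 := solution_orient xI.
rewrite /w mulrCA; apply/andP; split; last by rewrite ler_wpM2r.
by rewrite mulr_ge0// (le_trans (ltW c2_gt0)).
Qed.

Lemma solution_monotone : nondecreasing_fun (fun x => s * u x).
Proof.
(* [u] is constant outside [- M, M]: it factors through the projection. *)
pose cl (x : R) := Num.max (- M) (Num.min x M).
have ucl x : u x = u (cl x).
  rewrite /cl; have [xM|Mx] := leP x M.
    have [//|Mx] := leP (- M) x; last rewrite (vs_u_extl uv) ?(vs_u_left uv)// ltW//.
  rewrite max_r ?(vs_u_extr uv) ?(vs_u_right uv) ?(ltW Mx)//.
  by rewrite ge0_cp// ltW.
move=> x y xy; rewrite (ucl x) (ucl y).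
have clI z : cl z \in `[- M, M].
  by rewrite in_itv/= /cl le_max lexx/= ge_max ge_min lexx orbT andbT ge0_cp// ltW.
have clxy : cl x <= cl y.
  rewrite /cl ge_max !le_max lexx/=; apply/orP; right.
  by rewrite le_min !ge_min xy lexx/= orbT.
have sub (z : R) : z \in `]cl x, cl y[ -> z \in `]- M, M[.
  have /itvP xI := clI x; have /itvP yI := clI y.
  by move=> /itvP zI; rewrite in_itv/= (@le_lt_trans _ _ (cl x)) ?xI ?zI//= (@lt_le_trans _ _ (cl y)) ?yI ?zI.
have fd z (zI : z \in `]cl x, cl y[) := is_deriveZ s (solution_u_derive (sub z zI)).
have uc : {within `[cl x, cl y], continuous (s \*: u)}.
  have uc1 : {within `[cl x, cl y], continuous u}.
    apply: (continuous_subspaceW _ (vs_u_cont uv)); apply: subset_itv; rewrite bnd_simp.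
      by have /itvP -> := clI x.
    by have /itvP -> := clI y.
  by move=> z; apply: continuousZl_tmp; exact: uc1.
by apply: (le_of_derive_ge0 clxy fd uc) => z /sub; exact: solution_orient.
Qed.

Let D := s * uR - s * uL.

Lemma flux_speed_le (a b : R) : Omega uL uR a -> b \in `[-1, 1] ->
  `|A1 a b| <= Lambda * A0 a b.
Proof.
move=> aO bI; have A0p : 0 < A0 a b := lt_le_trans c1_gt0 (A0_ge a bI).
have := lam_le aO bI; rewrite /lam normrM normfV (gtr0_norm A0p).
by rewrite ler_pdivrMr.
Qed.

Let ends (x : R) : s * uL <= s * u x <= s * uR.
Proof.
have [h1|h1] := leP (- M) x; have [h2|h2] := leP x M.
- rewrite -[X in s * X <= _ <= _](vs_u_left uv) -[X in _ <= _ <= s * X](vs_u_right uv).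
  by rewrite !solution_monotone.
- by rewrite (vs_u_extr uv) ?(ltW h2)// lexx andbT -subr_ge0 -mulrBr.
- by rewrite (vs_u_extl uv) ?(ltW h1)// lexx/= -subr_ge0 -mulrBr.
- by have := lt_trans h2 h1; move: M_gt0; lra.
Qed.

Let s_norm : `|s| = 1.
Proof. exact: normr_sqr1. Qed.

Let layer_bounds (th x z : R) : 0 < th -> 0 <= s * w x ->
  c1 * th * z <= eps * (s * w x) -> s * w x * th <= c3 * D ->
  `|w x| <= c3 * D / th /\ z <= eps * (c3 * D / (c1 * th ^+ 2)).
Proof.
move=> th0 w0 h1 h2.
have wE : `|w x| = s * w x by rewrite -[RHS](ger0_norm w0) [RHS]normrM s_norm mul1r.
have h3 : s * w x <= c3 * D / th by rewrite ler_pdivlMr.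
rewrite wE; split=> //.
rewrite -(ler_pM2l (x := c1 * th)) ?mulr_gt0// (le_trans h1)//.
have -> : c1 * th * (eps * (c3 * D / (c1 * th ^+ 2))) = eps * (c3 * D / th).
  by field; rewrite !gt_eqF.
by rewrite ler_wpM2l// ltW.
Qed.

(** At distance [th] beyond the maximal speed the equation reads
    [eps * w' >= c1 * th * u'] up to the sign [s], which is the setting of the
    decay estimate on [`]- M, - Lambda - th[]. *)
Lemma solution_left_layer (th x : R) : 0 < th -> x \in `]- M, M[ ->
  x <= - Lambda - 2 * th ->
  `|w x| <= c3 * D / th /\ `|u x - uL| <= eps * (c3 * D / (c1 * th ^+ 2)).
Proof.
move=> th0 xI xth; have /itvP xI' := xI.
have subr (y : R) : y \in `]- M, - Lambda - th] -> y \in `]- M, M[.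
  by move=> /itvP yI; rewrite in_itv/= yI/= (@le_lt_trans _ _ (- Lambda - th)) ?yI//; move: M_gt0 Lambda_ge0; lra.
have subo (y : R) : y \in `]- M, - Lambda - th[ -> y \in `]- M, M[.
  by move=> /itvP yI; apply: subr; rewrite in_itv/= !yI.
have ud (y : R) (yI : y \in `]- M, - Lambda - th]) : is_derive y 1 (fun y => s * u y) (s * du y) :=
  is_deriveZ s (solution_u_derive (subr y yI)).
have wd (y : R) (yI : y \in `]- M, - Lambda - th[) : is_derive y 1 (fun y => s * w y) (s * derive1 w y) :=
  is_deriveZ s (solution_w_derive (subo y yI)).
have ode (y : R) : y \in `]- M, - Lambda - th[ ->
    c1 * th * (s * du y) <= eps * (s * derive1 w y).
  move=> yI; have yO := subo y yI; have yc := oc yO.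
  have E : eps * derive1 w y = (- y * A0 (u y) (v y) + A1 (u y) (v y)) * du y.
    exact: esym (vs_u_ode uv yO).
  rewrite [leRHS]mulrCA E [leRHS]mulrCA ler_wpM2r ?solution_orient//.
  have := flux_speed_le (vs_u_range uv yc) (vs_v_range uv yc).
  have := A0_ge (u y) (vs_v_range uv yc).
  set a0 := A0 _ _; set a1 := A1 _ _ => ha0 /ler_normlP[ha1 _].
  have ylt : y <= - Lambda - th by rewrite (itvP yI).
  have yr : th <= - y - Lambda by lra.
  have : c1 * th <= a0 * (- y - Lambda) by apply: ler_pM => //; exact: ltW.
  lra.
have xr : x \in `]- M, - Lambda - th[ by rewrite in_itv/= xI'/=; lra.
have [h1 h2] := decay_estimate B0_upper_gt0 (ltW (mulr_gt0 c1_gt0 th0)) eps_gt0 ud wd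
  (fun y yI => solution_w_bound (subo y yI)) ode xr.
have /andP[w0 _] := solution_w_bound xI.
have -> : `|u x - uL| = s * u x - s * uL.
  rewrite -mulrBr -[RHS]ger0_norm ?normrM ?s_norm ?mul1r//.
  by rewrite mulrBr subr_ge0; have /andP[] := ends x.
apply: layer_bounds => //.
- have MM : - M < M by rewrite gtrN.
  have [_ ucl _] := (continuous_within_itvP u MM).1 (vs_u_cont uv).
  rewrite (vs_u_left uv) in ucl.
  have L : c1 * th * (s * u x - s * u y) @[y --> (- M)^'+] --> c1 * th * (s * u x - s * uL).
    apply: cvgM; first exact: cvg_cst.
    by apply: cvgB; [exact: cvg_cst|apply: cvgM => //; exact: cvg_cst].
  apply: (cvgr_to_le L); near=> y; apply: h1.
  by rewrite in_itv/=; apply/andP; split; near: y; [exact: nbhs_right_gt|apply: nbhs_right_le; rewrite xI'].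
- apply: (@le_trans _ _ (s * w x * (- Lambda - th - x))); first by rewrite ler_wpM2l//; lra.
  apply: (le_trans h2); rewrite ler_wpM2l ?(ltW B0_upper_gt0)// /D lerB//.
    by have /andP[] := ends (- Lambda - th).
  by have /andP[] := ends x.
Unshelve. all: by end_near. Qed.

(** Mirror image of the left layer: the decay estimate applies to
    [- s * u (- x)] with flux [s * w (- x)]. *)
Lemma solution_right_layer (th x : R) : 0 < th -> x \in `]- M, M[ ->
  Lambda + 2 * th <= x ->
  `|w x| <= c3 * D / th /\ `|u x - uR| <= eps * (c3 * D / (c1 * th ^+ 2)).
Proof.
move=> th0 xI xth; have /itvP xI' := xI.
have opp (y : R) : y \in `]- M, M[ -> - y \in `]- M, M[.
  by move=> /itvP yI; rewrite in_itv/= ltrN2 ltrNl !yI.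
have subr (y : R) : y \in `]- M, - Lambda - th] -> - y \in `]- M, M[.
  move=> /itvP yI; apply: opp.
  by rewrite in_itv/= yI/= (@le_lt_trans _ _ (- Lambda - th)) ?yI//; move: M_gt0 Lambda_ge0; lra.
have subo (y : R) : y \in `]- M, - Lambda - th[ -> - y \in `]- M, M[.
  by move=> /itvP yI; apply: subr; rewrite in_itv/= !yI.
have ud (y : R) : y \in `]- M, - Lambda - th] ->
    is_derive y 1 (fun y => - s * u (- y)) (s * du (- y)).
  move=> yI; rewrite -[s * _]mulrNN.
  exact: (is_deriveZ (- s) (is_derive_reflect (solution_u_derive (subr y yI)))).
have wd (y : R) : y \in `]- M, - Lambda - th[ ->
    is_derive y 1 (fun y => s * w (- y)) (s * - derive1 w (- y)).
  move=> yI.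
  exact: (is_deriveZ s (is_derive_reflect (solution_w_derive (subo y yI)))).
have ode (y : R) : y \in `]- M, - Lambda - th[ ->
    c1 * th * (s * du (- y)) <= eps * (s * - derive1 w (- y)).
  move=> yI; have yO := subo y yI; have yc := oc yO.
  have E : eps * derive1 w (- y) =
      (- - y * A0 (u (- y)) (v (- y)) + A1 (u (- y)) (v (- y))) * du (- y).
    exact: esym (vs_u_ode uv yO).
  rewrite [leRHS]mulrCA mulrN E -mulNr [leRHS]mulrCA ler_wpM2r ?solution_orient//.
  have := flux_speed_le (vs_u_range uv yc) (vs_v_range uv yc).
  have := A0_ge (u (- y)) (vs_v_range uv yc).
  set a0 := A0 _ _; set a1 := A1 _ _ => ha0 /ler_normlP[_ ha1].
  have ylt : y <= - Lambda - th by rewrite (itvP yI).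
  have yr : th <= - y - Lambda by lra.
  have : c1 * th <= a0 * (- y - Lambda) by apply: ler_pM => //; exact: ltW.
  lra.
have xr : - x \in `]- M, - Lambda - th[ by rewrite in_itv/= ltrN2 xI'/=; lra.
have wB (y : R) : y \in `]- M, - Lambda - th[ ->
    0 <= s * w (- y) <= c3 * (s * du (- y)).
  by move=> yI; exact: solution_w_bound (subo y yI).
have [h1 h2] := decay_estimate B0_upper_gt0 (ltW (mulr_gt0 c1_gt0 th0)) eps_gt0 ud wd wB ode xr.
rewrite !opprK in h1 h2.
have /andP[w0 _] := solution_w_bound xI.
have -> : `|u x - uR| = s * uR - s * u x.
  rewrite -mulrBr distrC -[RHS]ger0_norm ?normrM ?s_norm ?mul1r//.
  by rewrite mulrBr subr_ge0; have /andP[] := ends x.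
apply: layer_bounds => //.
- have MM : - M < M by rewrite gtrN.
  have [_ _ ucr] := (continuous_within_itvP u MM).1 (vs_u_cont uv).
  rewrite (vs_u_right uv) in ucr.
  have L : c1 * th * (s * u y - s * u x) @[y --> M^'-] --> c1 * th * (s * uR - s * u x).
    apply: cvgM; first exact: cvg_cst.
    by apply: cvgB; [apply: cvgM => //; exact: cvg_cst|exact: cvg_cst].
  apply: (cvgr_to_le L); near=> y.
  have := h1 (- y); rewrite opprK !mulNr opprK (addrC (- _)); apply.
  rewrite in_itv/= ltrN2 lerN2; apply/andP; split; near: y; first exact: nbhs_left_lt.
  by apply: nbhs_left_ge; rewrite xI'.
- apply: (@le_trans _ _ (s * w x * (- Lambda - th + x))); first by rewrite ler_wpM2l//; lra.
  apply: (le_trans h2); rewrite ler_wpM2l ?(ltW B0_upper_gt0)// /D !mulNr opprK addrC lerB//.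
    by have /andP[] := ends x.
  by have /andP[] := ends (- (- Lambda - th)).
Unshelve. all: by end_near. Qed.
End solution.

(** * Weak inequalities up to the constant states *)

Section weak_form.
Context (R : realType) (phi dphi E Q g A B u0 : R -> R).
Context (phid : forall x : R, is_derive x 1 phi (dphi x)) (dphic : continuous dphi).
Let mu := @lebesgue_measure R.
Let I x := E (u0 x) * (phi x + x * dphi x) - Q (u0 x) * dphi x.
Let bd x := x * phi x * E (u0 x) - Q (u0 x) * phi x.

Lemma weak_form_constant (a b q : R) : a <= b ->
  (forall x, x \in `[a, b] -> u0 x = q) ->
  \int[mu]_(x in `[a, b]) I x = bd b - bd a.
Proof.
move=> ab uq.
have uI x : x \in `[a, b] -> I x = E q * (phi x + x * dphi x) - Q q * dphi x.
  by move=> /uq h; rewrite /I h.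
transitivity (\int[mu]_(x in `[a, b]) (E q * (phi x + x * dphi x) - Q q * dphi x)).
  by apply: eq_Rintegral => x /set_mem; exact: uI.
have phic := is_derive_continuousT phid.
have Fd (x : R) : is_derive x 1 (fun x => x * phi x * E q - Q q * phi x)
    (E q * (phi x + x * dphi x) - Q q * dphi x).
  have ? := phid x; apply: is_derive_eq; rewrite /GRing.scale/=; ring.
rewrite (Rintegral_derive ab Fd).
  by rewrite /bd !uq// in_itv/= lexx ?andbT.
move=> x; apply: cvgB; apply: cvgM; try exact: cvg_cst; last exact: dphic.
by apply: cvgD; [exact: phic|apply: cvgM; [exact: cvg_id|exact: dphic]].
Qed.

Context (l r s c K ml mr : R) (eps : nat -> R) (u du w dw a0 a1 : nat -> R -> R).
Context (fam : viscous_family l r s c K ml mr eps u du w dw a0 a1)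
  (eps0 : eps n @[n --> \oo] --> (0 : R))
  (uu0 : forall x, u n x @[n --> \oo] --> u0 x)
  (Ed : forall y : R, is_derive y 1 E (g y * A y))
  (Qd : forall y : R, is_derive y 1 Q (g y * B y))
  (gc : continuous g)
  (mult : multiplier_approx ml mr g phi).

Let coef_cvg (a b : R) := forall d, 0 < d -> \forall n \near \oo, forall x, x \in `[a, b] ->
     `|A (u n x) - a0 n x| <= d /\ `|B (u n x) - a1 n x| <= d.

Let flux_cvg0 (W x : R) : (forall n, `|w n x| <= W) ->
  eps n * w n x * phi x @[n --> \oo] --> (0 : R).
Proof.
move=> wW; apply: norm_cvg0.
have L : eps n * (W * `|phi x|) @[n --> \oo] --> (0 : R).
  by rewrite -[X in _ --> X](mul0r (W * `|phi x|)); apply: cvgM => //; exact: cvg_cst.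
apply: (squeeze_cvgr _ (cvg_cst 0) L); apply: nearW => n; rewrite normr_ge0/=.
rewrite !normrM gtr0_norm ?(vf_eps_gt0 fam)// -mulrA ler_wpM2l ?(ltW (vf_eps_gt0 fam n))//.
by rewrite ler_wpM2r.
Qed.

Let flux0 x : phi x = 0 -> eps n * w n x * phi x @[n --> \oo] --> (0 : R).
Proof. by move=> ->; under eq_fun do rewrite mulr0; exact: cvg_cst. Qed.

(** On [`[a, m]] the limit is constant and the integral is explicit; on
    [`[m, b]] the entropy limit applies. At [m] the boundary terms of the two
    pieces cancel, because the viscous one vanishes with [eps] when the flux is
    bounded there. *)
Lemma weak_form_left (a m b q W : R) : a <= m -> l < m -> m < b -> b < r ->
  mu.-integrable `[a, b] (EFin \o I) ->
  phi a = 0 -> phi b = 0 ->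
  (forall x, x <= m -> u0 x = q) -> (forall n, `|w n m| <= W) ->
  coef_cvg m b ->
  \int[mu]_(x in `[a, b]) I x <= 0.
Proof.
move=> am lm mb br Ii pa pb uq wW cc.
rewrite (Rintegral_cat am (ltW mb) Ii) (@weak_form_constant a m q)//; last first.
  by move=> x /itvP xI; apply: uq; rewrite xI.
have := entropy_limit fam eps0 lm mb br (fun x _ => @uu0 x) cc phid dphic Ed Qd gc
  mult (flux_cvg0 wW) (flux0 pb).
rewrite -/(bd b) -/(bd m) -/I.
have -> : bd b = 0 by rewrite /bd pb !mulr0 mul0r subrr.
have -> : bd a = 0 by rewrite /bd pa !mulr0 mul0r subrr.
lra.
Qed.

Lemma weak_form_right (a m b q W : R) : l < a -> a < m -> m < r -> m <= b ->
  mu.-integrable `[a, b] (EFin \o I) ->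
  phi a = 0 -> phi b = 0 ->
  (forall x, m <= x -> u0 x = q) -> (forall n, `|w n m| <= W) ->
  coef_cvg a m ->
  \int[mu]_(x in `[a, b]) I x <= 0.
Proof.
move=> la am mr_ mb Ii pa pb uq wW cc.
rewrite (Rintegral_cat (ltW am) mb Ii) (@weak_form_constant m b q)//; last first.
  by move=> x /itvP xI; apply: uq; rewrite xI.
have := entropy_limit fam eps0 la am mr_ (fun x _ => @uu0 x) cc phid dphic Ed Qd gc
  mult (flux0 pa) (flux_cvg0 wW).
rewrite -/(bd a) -/(bd m) -/I.
have -> : bd b = 0 by rewrite /bd pb !mulr0 mul0r subrr.
have -> : bd a = 0 by rewrite /bd pa !mulr0 mul0r subrr.
lra.
Qed.
End weak_form.

(** * Conservation laws and entropy inequalities on a half-line *)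

Section dissipation.
Context (R : realType) (s ml mr : R) (u0 : R -> R).
Context (s_sign : s * s = 1) (u0_mono : nondecreasing_fun (fun x => s * u0 x))
  (u0_range : forall x, u0 x \in `[ml, mr]).

(** The entropy inequalities stated for the generated pairs [E' = g * A],
    [Q' = g * B]: with [A = gamma'] and [B = (f \o gamma)'] these are the pairs
    [eta \o gamma], [q \o gamma] for [g = eta' \o gamma]. *)
Definition dissipative (D : set R) (A B : R -> R) : Prop :=
  forall E Q g phi : R -> R,
    (forall y : R, is_derive y 1 E (g y * A y)) ->
    (forall y : R, is_derive y 1 Q (g y * B y)) ->
    continuous g -> test_function D phi -> multiplier_approx ml mr g phi ->
    selfsimilar (E \o u0) (Q \o u0) phi <= 0.

Lemma selfsimilar_comp (E Q phi : R -> R) (a b : R) :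
  a < b -> continuous E -> continuous Q -> smooth phi ->
  (forall x, x \notin `]a, b[ -> phi x = 0) ->
  (@lebesgue_measure R).-integrable `[a, b]
    (EFin \o (fun x => E (u0 x) * (phi x + x * derive1 phi x) - Q (u0 x) * derive1 phi x)) /\
  selfsimilar (E \o u0) (Q \o u0) phi =
  \int[@lebesgue_measure R]_(x in `[a, b])
    (E (u0 x) * (phi x + x * derive1 phi x) - Q (u0 x) * derive1 phi x).
Proof.
move=> ab Ec Qc phis phi0.
have mu0 : measurable_fun setT u0.
  have -> : u0 = (fun x => s * x) \o (fun x => s * u0 x).
    by apply/funext => x /=; rewrite mulrA s_sign mul1r.
  apply: measurableT_comp; last exact: nondecreasing_measurable.
  exact: mulrl_measurable.
have cK := @segment_compact R ml mr.
have [CE CE0 EB] := continuous_compact_bound cK (continuous_subspaceT Ec).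
have [CQ CQ0 QB] := continuous_compact_bound cK (continuous_subspaceT Qc).
have dphic := is_derive_continuousT (fun x => is_derive_derive1 (phis 1%N x)).
apply: (@selfsimilar_itv R (E \o u0) (Q \o u0) phi a b (CE + CQ) ab).
- by apply: measurableT_comp => //; exact: continuous_measurable_fun.
- by apply: measurableT_comp => //; exact: continuous_measurable_fun.
- by move=> x; rewrite (le_trans (EB _ (u0_range x)))// lerDl.
- by move=> x; rewrite (le_trans (QB _ (u0_range x)))// lerDr.
- exact: (phis 0%N).
- exact: dphic.
move=> x xab; split.
  apply: phi0; apply: contra xab; exact: subset_itv_oo_cc.
rewrite derive1E (@near_eq_derive _ _ _ phi (cst 0)) ?derive_cst//.
have oC : open (~` `[a, b]%classic) by apply: closed_openC; exact: itv_closed.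
have xC : (~` `[a, b]%classic) x by move=> /= h; rewrite h in xab.
have := open_nbhs_nbhs (conj oC xC); apply: filterS => y yC.
apply: phi0; apply/negP => h; apply: yC; exact: subset_itv_oo_cc.
Qed.

(** The multipliers [1] and [-1] are constant, so their inequalities hold for
    test functions of any sign and are opposite to each other. *)
Lemma dissipative_conservation (D : set R) (A B gam f : R -> R) : ~ D 0 ->
  dissipative D A B ->
  (forall y : R, is_derive y 1 gam (A y)) ->
  (forall y : R, is_derive y 1 (f \o gam) (B y)) ->
  distr_eq0 D (selfsimilar (gam \o u0) (f \o (gam \o u0))).
Proof.
move=> D0 diss gamd fd phi tphi.
have multc (k : R) : multiplier_approx ml mr (fun=> k) phi.
  move=> kap kap0; exists (fun=> k), (fun=> 0); split=> [y|x y _|y _].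
  - exact: is_derive_cst.
  - by rewrite mul0r.
  - by rewrite subrr normr0 ltW.
have le1 : selfsimilar (gam \o u0) ((f \o gam) \o u0) phi <= 0.
  apply: (diss gam (f \o gam) (fun=> 1) phi) => //.
  - by move=> y; rewrite mul1r.
  - by move=> y; rewrite mul1r.
  - by move=> y; exact: cvg_cst.
have ge1 : selfsimilar ((fun y => - gam y) \o u0) ((fun y => - (f \o gam) y) \o u0) phi <= 0.
  apply: (diss _ _ (fun=> -1) phi) => //.
  - by move=> y; exact: cvg_cst.
have [a [b [ab phi0]]] := test_function_segment tphi D0.
have [phis _] := tphi.
have gamc := is_derive_continuousT gamd; have fc := is_derive_continuousT fd.
have gamNc : continuous (fun y => - gam y) by move=> y; apply: cvgN; exact: gamc.
have fNc : continuous (fun y => - (f \o gam) y) by move=> y; apply: cvgN; exact: fc.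
have [Ii E1] := selfsimilar_comp ab gamc fc phis phi0.
have [_ E2] := selfsimilar_comp ab gamNc fNc phis phi0.
have EN : selfsimilar ((fun y => - gam y) \o u0) ((fun y => - (f \o gam) y) \o u0) phi =
    - selfsimilar (gam \o u0) ((f \o gam) \o u0) phi.
  rewrite E2 E1 -mulN1r -RintegralZl//.
  by apply: eq_Rintegral => x _; ring.
apply/eqP; rewrite eq_le; apply/andP; split; first exact: le1.
by rewrite EN oppr_le0 in ge1.
Qed.

(** [eta'] is continuous and nondecreasing, so its difference quotients,
    composed with the nondecreasing [gam], are admissible multipliers for
    nonnegative test functions. *)
Lemma dissipative_entropy (D : set R) (A B gam f eta q : R -> R) :
  dissipative D A B ->
  (forall y : R, is_derive y 1 gam (A y)) -> (forall y : R, 0 <= A y) ->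
  (forall y, B y = derive1 f (gam y) * A y) ->
  convex_function [set: R] eta -> (forall y : R, derivable eta y 1) ->
  entropy_flux eta f q ->
  distr_le0 D (selfsimilar (eta \o (gam \o u0)) (q \o (gam \o u0))).
Proof.
move=> diss gamd A0 BE ec ed qf phi tphi phi_ge0.
have gamc := is_derive_continuousT gamd.
have detac := convex_derive1_continuous ec ed.
apply: (diss (eta \o gam) (q \o gam) (derive1 eta \o gam) phi) => //.
- move=> y; exact: (is_derive1_comp (is_derive_derive1 (ed (gam y))) (gamd y)).
- move=> y; have [qd qE] := qf (gam y).
  by rewrite BE /= mulrA -qE; exact: (is_derive1_comp (is_derive_derive1 qd) (gamd y)).
- by move=> y; exact: (continuous_comp (gamc y) (detac (gam y))).
move=> kap kap0.
have [N N0 gN] := continuous_compact_bound (@segment_compact R ml mr) (continuous_subspaceT gamc).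
have [k [dk [kd dk0 kapp]]] := convex_derive1_approx ec ed (- N) N kap0.
exists (k \o gam), (fun y => dk (gam y) * A y); split.
- by move=> y; exact: is_derive1_comp.
- by move=> x y _; rewrite !mulr_ge0.
- by move=> y yI; apply: kapp; rewrite in_itv/= -ler_norml; exact: gN.
Qed.

Context (l r c K : R) (eps : nat -> R) (u du w dw a0 a1 : nat -> R -> R).
Context (fam : viscous_family l r s c K ml mr eps u du w dw a0 a1)
  (eps0 : eps n @[n --> \oo] --> (0 : R))
  (uu0 : forall x, u n x @[n --> \oo] --> u0 x) (A B : R -> R).

Lemma dissipative_left (m q W : R) : l < m -> m < 0 -> 0 < r ->
  (forall x, x <= m -> u0 x = q) -> (forall n, `|w n m| <= W) ->
  (forall b d, m < b -> b < 0 -> 0 < d -> \forall n \near \oo, forall x, x \in `[m, b] ->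
     `|A (u n x) - a0 n x| <= d /\ `|B (u n x) - a1 n x| <= d) ->
  dissipative `]-oo, 0[ A B.
Proof.
move=> lm m0 r0 uq wW AB E Q g phi Ed Qd gc tphi mult.
have D0 : ~ (`]-oo, 0[%classic : set R) 0 by rewrite /= in_itv/= ltxx.
have [d [N [d0 N0 dN]]] := test_function_support tphi D0.
(* [phi] lives where [d <= |x| <= N]; [b] lies above both [m] and [- d], and
   below the origin. *)
pose a := m - N - 1; pose b := Num.max (m / 2) (- d / 2).
have mb : m < b by rewrite /b lt_max; apply/orP; left; lra.
have b0 : b < 0 by rewrite /b gt_max; apply/andP; split; lra.
have am : a <= m by rewrite /a; lra.
have db : - d / 2 <= b by rewrite /b le_max lexx orbT.
have phi0 x : x \notin `]a, b[ -> phi x = 0.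
  move=> xN; apply/eqP/negPn/negP => /dN[]; rewrite /= in_itv/= => x0.
  rewrite ltr0_norm// => /andP[dx xN']; move/negP: xN; apply.
  by rewrite in_itv/= /a; apply/andP; split; lra.
have [phis _] := tphi.
have phid x := is_derive_derive1 (phis 0%N x).
have dphid x := is_derive_derive1 (phis 1%N x).
have [Ii ->] := selfsimilar_comp (le_lt_trans am mb) (is_derive_continuousT Ed) (is_derive_continuousT Qd) phis phi0.
apply: (weak_form_left phid (is_derive_continuousT dphid) fam eps0 uu0 Ed Qd gc mult am lm mb _ Ii _ _ uq wW).
- exact: lt_trans r0.
- by apply: phi0; rewrite in_itv/= ltxx.
- by apply: phi0; rewrite in_itv/= ltxx andbF.
- by move=> e e0; exact: AB.
Qed.

Lemma dissipative_right (m q W : R) : l < 0 -> 0 < m -> m < r ->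
  (forall x, m <= x -> u0 x = q) -> (forall n, `|w n m| <= W) ->
  (forall a d, 0 < a -> a < m -> 0 < d -> \forall n \near \oo, forall x, x \in `[a, m] ->
     `|A (u n x) - a0 n x| <= d /\ `|B (u n x) - a1 n x| <= d) ->
  dissipative `]0, +oo[ A B.
Proof.
move=> l0 m0 mr' uq wW AB E Q g phi Ed Qd gc tphi mult.
have D0 : ~ (`]0, +oo[%classic : set R) 0 by rewrite /= in_itv/= ltxx.
have [d [N [d0 N0 dN]]] := test_function_support tphi D0.
pose b := m + N + 1; pose a := Num.min (m / 2) (d / 2).
have am : a < m by rewrite /a gt_min; apply/orP; left; lra.
have a_gt0 : 0 < a by rewrite /a lt_min; apply/andP; split; lra.
have mb : m <= b by rewrite /b; lra.
have ad : a <= d / 2 by rewrite /a ge_min lexx orbT.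
have phi0 x : x \notin `]a, b[ -> phi x = 0.
  move=> xN; apply/eqP/negPn/negP => /dN[]; rewrite /= in_itv/= andbT => x0.
  rewrite gtr0_norm// => /andP[dx xN']; move/negP: xN; apply.
  by rewrite in_itv/= /b; apply/andP; split; lra.
have [phis _] := tphi.
have phid x := is_derive_derive1 (phis 0%N x).
have dphid x := is_derive_derive1 (phis 1%N x).
have [Ii ->] := selfsimilar_comp (lt_le_trans am mb) (is_derive_continuousT Ed) (is_derive_continuousT Qd) phis phi0.
apply: (weak_form_right phid (is_derive_continuousT dphid) fam eps0 uu0 Ed Qd gc mult _ am mr' mb Ii _ _ uq wW).
- exact: lt_trans a_gt0.
- by apply: phi0; rewrite in_itv/= ltxx.
- by apply: phi0; rewrite in_itv/= ltxx andbF.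
- by move=> e e0; exact: AB.
Qed.
End dissipation.

(** * The Riemann problem *)

(** The convergence is uniform in [x], even where that of [un] is not, because
    [un] takes its values in a compact set. *)
Lemma layer_coef_cvg (R : realType) (F : R * R -> R) (ml mr sigma a b : R)
    (un vn : nat -> R -> R) (tau : nat -> R) :
  continuous F ->
  (forall n x, x \in `[a, b] -> un n x \in `[ml, mr]) ->
  (forall n x, x \in `[a, b] -> `|vn n x - sigma| <= tau n) ->
  tau n @[n --> \oo] --> (0 : R) ->
  forall d, 0 < d -> \forall n \near \oo, forall x, x \in `[a, b] ->
    `|F (un n x, sigma) - F (un n x, vn n x)| <= d.
Proof.
move=> cF uI vtau tau0 d d0.
have [r /= r0 rP] := continuous_unif_compact sigma cF (@segment_compact R ml mr) d0.
have /cvgrPdist_lt /(_ _ r0) [N _ NP] := tau0.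
exists N => // n /= Nn x xI; rewrite distrC ltW//.
apply: rP; last exact: uI.
rewrite /= distrC (le_lt_trans (vtau n x xI))//.
by have := NP n Nn; rewrite /= sub0r normrN; apply: le_lt_trans; exact: ler_norm.
Qed.

(** [f] or [- f] is nondecreasing, so its variation on a segment is the
    difference of its values at the ends. *)
Lemma monotone_BV_line (R : realType) (s C : R) (f : R -> R) : s * s = 1 ->
  nondecreasing_fun (fun x => s * f x) -> (forall x, `|f x| <= C) -> BV_line f.
Proof.
move=> s1 fnd fC.
have TV (a b : R) : a <= b -> total_variation a b f = (s * f b - s * f a)%:E.
  move=> ab; have nd : {in `[a, b] &, nondecreasing_fun (fun x => s * f x)}.
    by move=> x y _ _; exact: fnd.
  rewrite -(nondecreasing_total_variation ab nd).
  have : (s - 1) * (s + 1) = 0 by rewrite -subr_sqr expr1n expr2 s1 subrr.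
  move=> /eqP; rewrite mulf_eq0 subr_eq0 addr_eq0 => /orP[] /eqP->.
    by congr total_variation; apply/funext => x; rewrite mul1r.
  rewrite -total_variationN; congr total_variation.
  by apply/funext => x /=; rewrite mulN1r.
have sn := normr_sqr1 s1.
apply: (@le_lt_trans _ _ (C + C)%:E); last exact: ltry.
apply: ub_ereal_sup => _ [[a b] /= ab <-]; rewrite TV// lee_fin.
rewrite (le_trans (ler_norm _))// (le_trans (ler_normB _ _))// !normrM sn !mul1r.
by rewrite lerD.
Qed.

Lemma increasing_seq_ge (s : nat -> nat) : increasing_seq s -> forall n, (n <= s n)%N.
Proof.
by move=> /increasing_seqP sS; elim=> // n IH; exact: leq_ltn_trans IH (sS n).
Qed.

Lemma cvg_increasing_seq (R : realType) (e : nat -> R) (l : R) (s : nat -> nat) :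
  increasing_seq s -> e n @[n --> \oo] --> l -> e (s n) @[n --> \oo] --> l.
Proof.
move=> sinc /cvgrPdist_lt el; apply/cvgrPdist_lt => d /el[N _ NP].
exists N => // n /= Nn; apply: NP => /=.
exact: leq_trans Nn (increasing_seq_ge sinc n).
Qed.

Lemma cvg_powR0 (R : realType) (e : nat -> R) (p : R) : 0 < p ->
  (forall n, 0 < e n) -> e n @[n --> \oo] --> (0 : R) ->
  e n `^ p @[n --> \oo] --> (0 : R).
Proof. by move=> p0 e0 ec; apply: ((cvg_at_rightP _ _ _).1 (powR_cvg0 p0)). Qed.

Unset Implicit Arguments.

Theorem theorem3p5 (R : realType) (uL uR p c1 c2 c3 Lambda M : R)
  (A0 A1 B0 : R -> R -> R) (fm fp gm gp : R -> R) (u v : R -> R -> R)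
  (p_gt0 : 0 < p)
  (A0_smooth : smooth2 A0) (A1_smooth : smooth2 A1) (B0_smooth : smooth2 B0)
  (c1_gt0 : 0 < c1) (c2_gt0 : 0 < c2)
  (A0_ge : forall a b : R, b \in `[-1, 1] -> c1 <= A0 a b)
  (B0_bounds : forall a b : R, b \in `[-1, 1] -> c2 <= B0 a b <= c3)
  (fm_smooth : smooth fm) (fp_smooth : smooth fp)
  (gm_smooth : smooth gm) (gp_smooth : smooth gp)
  (gm_bij : bijective gm) (gp_bij : bijective gp)
  (A0_m : forall a : R, A0 a (-1) = derive1 gm a)
  (A0_p : forall a : R, A0 a 1 = derive1 gp a)
  (A1_m : forall a : R, A1 a (-1) = derive1 (fm \o gm) a)
  (A1_p : forall a : R, A1 a 1 = derive1 (fp \o gp) a)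
  (Lambda_gt0 : 0 < Lambda)
  (lam_le : forall a b : R, Omega uL uR a -> b \in `[-1, 1] ->
     `|lam A0 A1 a b| <= Lambda)
  (Lambda_lt_M : Lambda < M)
  (uv_sol : forall eps : R, 0 < eps ->
     viscous_solution uL uR p M A0 A1 B0 eps (u eps) (v eps)) :
  forall e : nat -> R, (forall n, 0 < e n) -> e n @[n --> \oo] --> (0 : R) ->
  exists (s : nat -> nat) (u0 : R -> R),
    increasing_seq s /\
    (forall xi : R, u (e (s n)) xi @[n --> \oo] --> u0 xi) /\
    BV_line u0 /\
    distr_eq0 `]-oo, 0[ (selfsimilar (gm \o u0) (fm \o (gm \o u0))) /\
    distr_eq0 `]0, +oo[ (selfsimilar (gp \o u0) (fp \o (gp \o u0))) /\
    (forall eta qm qp : R -> R,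
       convex_function [set: R] eta -> (forall x : R, derivable eta x 1) ->
       entropy_flux eta fm qm -> entropy_flux eta fp qp ->
       distr_le0 `]-oo, 0[
         (selfsimilar (eta \o (gm \o u0)) (qm \o (gm \o u0))) /\
       distr_le0 `]0, +oo[
         (selfsimilar (eta \o (gp \o u0)) (qp \o (gp \o u0)))) /\
    u0 xi @[xi --> -oo] --> uL /\
    u0 xi @[xi --> +oo] --> uR.
Proof.
move=> e e0 ecvg.
have M_gt0 : 0 < M := lt_trans Lambda_gt0 Lambda_lt_M.
have L0 := ltW Lambda_gt0.
pose ml := Num.min uL uR; pose mr := Num.max uL uR.
have [s [s1 sor]] : exists s : R, s * s = 1 /\ 0 <= s * (uR - uL).
  have [LR|RL] := leP uL uR.
    by exists 1; rewrite !mul1r subr_ge0.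
  by exists (-1); rewrite mulrNN !mul1r mulN1r opprB subr_ge0 ltW.
have F0c : continuous (fun z : R * R => A0 z.1 z.2) by have [] := A0_smooth 0%N.
have F1c : continuous (fun z : R * R => A1 z.1 z.2) by have [] := A1_smooth 0%N.
have [K coefK] : exists K : R, forall a b x : R, Omega uL uR a -> b \in `[-1, 1] ->
    `|x| <= M -> `|- x * A0 a b + A1 a b| <= K.
  have cK := compact_setX (@segment_compact R ml mr) (@segment_compact R (-1) 1).
  have [K0 K00 K0P] := continuous_compact_bound cK (continuous_subspaceT F0c).
  have [K1 K10 K1P] := continuous_compact_bound cK (continuous_subspaceT F1c).
  exists (M * K0 + K1) => a b x aO bI xM.
  rewrite (le_trans (ler_normD _ _))// lerD//; last exact: (K1P (a, b)).
  by rewrite normrM normrN ler_pM//; exact: (K0P (a, b)).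
have uv n := uv_sol (e n) (e0 n).
have und n : nondecreasing_fun (fun x => s * u (e n) x).
  exact: (solution_monotone c2_gt0 M_gt0 B0_bounds coefK (e0 n) sor (uv n)).
have urange n x : u (e n) x \in `[ml, mr].
  have [xM|Mx] := leP x (- M).
    by rewrite (vs_u_extl (uv n) xM) in_itv/= ge_min le_max lexx.
  have [xM|xM] := leP M x.
    by rewrite (vs_u_extr (uv n) xM) in_itv/= ge_min le_max lexx !orbT.
  by apply: (vs_u_range (uv n)); rewrite in_itv/= !ltW.
pose C := `|ml| + `|mr|.
have itvC x : x \in `[ml, mr] -> `|x| <= C.
  move=> /itvP xI; rewrite ler_norml; apply/andP; split.
    rewrite lerNl (@le_trans _ _ (- ml)) ?lerN2 ?xI// (le_trans (ler_norm _))//.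
    by rewrite normrN lerDl.
  by rewrite (@le_trans _ _ mr) ?xI// (le_trans (ler_norm _))// lerDr.
have sn := normr_sqr1 s1.
have ubound n x : `|s * u (e n) x| <= C by rewrite normrM sn mul1r; exact: itvC.
(* Helly's theorem applies to [s * u]; multiplying by [s] again undoes it. *)
have [sig [g [sinc gnd scvg]]] := helly_selection und ubound.
pose u0 x := s * g x.
have uu0 x : u (e (sig n)) x @[n --> \oo] --> u0 x.
  have -> : (fun n => u (e (sig n)) x) = (fun n => s * (s * u (e (sig n)) x)).
    by apply/funext => n; rewrite mulrA s1 mul1r.
  by apply: cvgM; [exact: cvg_cst|exact: scvg].
have u0_mono : nondecreasing_fun (fun x => s * u0 x).
  by move=> x y xy; rewrite /u0 !mulrA s1 !mul1r; exact: gnd.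
have u0_range x : u0 x \in `[ml, mr].
  rewrite in_itv/=; apply/andP; split.
    apply: (cvgr_to_ge (uu0 x)); apply: nearW => n.
    by have := urange (sig n) x; rewrite in_itv/= => /andP[].
  apply: (cvgr_to_le (uu0 x)); apply: nearW => n.
  by have := urange (sig n) x; rewrite in_itv/= => /andP[].
pose eps n := e (sig n).
have eps_gt0 n : 0 < eps n by exact: e0.
have eps_cvg : eps n @[n --> \oo] --> (0 : R) := cvg_increasing_seq sinc ecvg.
have uvs n := uv (sig n).
pose w n : R -> R := fun z => B0 (u (eps n) z) (v (eps n) z) * derive1 (u (eps n)) z.
have fam : viscous_family (- M) M s c3 K ml mr eps (fun n => u (eps n))
    (fun n => derive1 (u (eps n))) w (fun n => derive1 (w n))
    (fun n x => A0 (u (eps n) x) (v (eps n) x)) (fun n x => A1 (u (eps n) x) (v (eps n) x)).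
  split=> //.
  - exact: ltW (B0_upper_gt0 c2_gt0 B0_bounds).
  - by move=> n x xI; exact: (solution_u_derive (uvs n) xI).
  - by move=> n x xI; exact: (solution_w_derive (uvs n) xI).
  - by move=> n x xI; exact: (solution_orient c2_gt0 M_gt0 B0_bounds coefK (eps_gt0 n) sor (uvs n) xI).
  - by move=> n x xI; exact: (solution_w_bound c2_gt0 M_gt0 B0_bounds coefK (eps_gt0 n) sor (uvs n) xI).
  - by move=> n x _; exact: urange.
  - by move=> n x xI; exact: esym (vs_u_ode (uvs n) xI).
  - move=> n x xI; have xc := subset_itv_oo_cc xI; apply: coefK.
    + exact: (vs_u_range (uvs n) xc).
    + exact: (vs_v_range (uvs n) xc).
    + by move: xc; rewrite in_itv/= ler_norml.
(* The cut [m] must satisfy [Lambda < m < M]: [m] is the midpoint. *)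
pose th := (M - Lambda) / 4.
have th0 : 0 < th by rewrite /th; lra.
pose m := Lambda + 2 * th.
have m0 : 0 < m by rewrite /m; lra.
have mM : m < M by rewrite /m /th; lra.
pose W := c3 * (s * uR - s * uL) / th.
pose W' := c3 * (s * uR - s * uL) / (c1 * th ^+ 2).
have left_layer n x : - M < x -> x <= - m -> `|w n x| <= W /\ `|u (eps n) x - uL| <= eps n * W'.
  move=> Mx xm; apply: (solution_left_layer c1_gt0 c2_gt0 M_gt0 L0 A0_ge B0_bounds lam_le
    coefK (eps_gt0 n) s1 sor (uvs n) th0).
    by rewrite in_itv/= Mx; lra.
  by move: xm; rewrite /m; lra.
have right_layer n x : x < M -> m <= x -> `|w n x| <= W /\ `|u (eps n) x - uR| <= eps n * W'.
  move=> Mx xm; apply: (solution_right_layer c1_gt0 c2_gt0 M_gt0 L0 A0_ge B0_bounds lam_le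
    coefK (eps_gt0 n) s1 sor (uvs n) th0) => //.
  by rewrite in_itv/= Mx andbT; lra.
have layer_lim x q : (forall n, `|u (eps n) x - q| <= eps n * W') -> u0 x = q.
  move=> uq; apply: (cvg_unique _ (uu0 x)) => //.
  have L : eps n * W' @[n --> \oo] --> (0 : R).
    by rewrite -[X in _ --> X](mul0r W'); apply: cvgM => //; exact: cvg_cst.
  apply/cvgrPdist_lt => d d0; move/cvgrPdist_lt : L => /(_ _ d0).
  apply: filterS => n /=; rewrite sub0r normrN distrC.
  by apply: le_lt_trans; rewrite (le_trans (uq n))// ler_norm.
have const_lim x q : (forall n, u (eps n) x = q) -> u0 x = q.
  move=> uq; apply: (cvg_unique _ (uu0 x)) => //.
  have -> : (fun n => u (e (sig n)) x) = fun=> q by apply/funext => n; exact: uq.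
  exact: cvg_cst.
have u0l x : x <= - m -> u0 x = uL.
  move=> xm; have [xM|Mx] := leP x (- M).
    by apply: const_lim => n; exact: (vs_u_extl (uvs n) xM).
  by apply: layer_lim => n; have [] := left_layer n x Mx xm.
have u0r x : m <= x -> u0 x = uR.
  move=> xm; have [xM|Mx] := leP M x.
    by apply: const_lim => n; exact: (vs_u_extr (uvs n) xM).
  by apply: layer_lim => n; have [] := right_layer n x Mx xm.
have vd n (x : R) : is_derive x 1 (v (eps n)) (derive1 (v (eps n)) x).
  by apply: is_derive_derive1; exact: (vs_v_derivable (uvs n)).
have vdd n (x : R) : is_derive x 1 (derive1 (v (eps n))) (derive1n 2 (v (eps n)) x).
  by apply: is_derive_derive1; exact: (vs_v_derivable2 (uvs n)).
have kap0 n : 0 < eps n `^ p by exact: powR_gt0.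
have kap_cvg (d : R) : 2 * eps n `^ p / d ^+ 2 @[n --> \oo] --> (0 : R).
  have -> : 0 = 2 * 0 / d ^+ 2 :> R by rewrite mulr0 mul0r.
  apply: cvgM; last exact: cvg_cst.
  by apply: cvgM; [exact: cvg_cst|exact: cvg_powR0].
have vleft b n x : x \in `[- m, b] -> b < 0 -> `|v (eps n) x - (-1)| <= 2 * eps n `^ p / (- b / 2) ^+ 2.
  move=> /itvP xI b0; apply: (layer_left (kap0 n) _ (vd n) (vdd n)).
  - lra.
  - exact: (vs_v_ode (uvs n)).
  - exact: (vs_v_left (uvs n)).
  - exact: (vs_v_right (uvs n)).
  - by rewrite mulrC divfK// opprK xI.
have vright a n x : x \in `[a, m] -> 0 < a -> `|v (eps n) x - 1| <= 2 * eps n `^ p / (a / 2) ^+ 2.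
  move=> /itvP xI a0; apply: (layer_right (kap0 n) _ (vd n) (vdd n)).
  - lra.
  - exact: (vs_v_ode (uvs n)).
  - exact: (vs_v_left (uvs n)).
  - exact: (vs_v_right (uvs n)).
  - by rewrite mulrC divfK// xI.
have dleft : dissipative ml mr u0 `]-oo, 0[ (derive1 gm) (derive1 (fm \o gm)).
  apply: (dissipative_left s1 u0_mono u0_range fam eps_cvg uu0 (m := - m) (q := uL) (W := W)).
  - by rewrite ltrN2.
  - by rewrite oppr_lt0.
  - by [].
  - exact: u0l.
  - by move=> n; have [] := left_layer n (- m); rewrite ?ltrN2.
  move=> b d mb b0 d0.
  have uI n x (_ : x \in `[- m, b]) := urange (sig n) x.
  have vI n x xI := vleft b n x xI b0.
  have h0 := layer_coef_cvg F0c uI vI (@kap_cvg _) d0.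
  have h1 := layer_coef_cvg F1c uI vI (@kap_cvg _) d0.
  near=> n => x xI; rewrite -A0_m -A1_m; split.
    by move: x xI; near: n; exact: h0.
  by move: x xI; near: n; exact: h1.
have dright : dissipative ml mr u0 `]0, +oo[ (derive1 gp) (derive1 (fp \o gp)).
  apply: (dissipative_right s1 u0_mono u0_range fam eps_cvg uu0 (m := m) (q := uR) (W := W)).
  - by rewrite oppr_lt0.
  - by [].
  - by [].
  - exact: u0r.
  - by move=> n; have [] := right_layer n m mM (lexx _).
  move=> a d a0 am d0.
  have uI n x (_ : x \in `[a, m]) := urange (sig n) x.
  have vI n x xI := vright a n x xI a0.
  have h0 := layer_coef_cvg F0c uI vI (@kap_cvg _) d0.
  have h1 := layer_coef_cvg F1c uI vI (@kap_cvg _) d0.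
  near=> n => x xI; rewrite -A0_p -A1_p; split.
    by move: x xI; near: n; exact: h0.
  by move: x xI; near: n; exact: h1.
have smd (f : R -> R) : smooth f -> forall y : R, is_derive y 1 f (derive1 f y).
  by move=> fs y; exact: is_derive_derive1 (fs 0%N y).
have compd (f h : R -> R) : smooth f -> smooth h -> forall y : R,
    is_derive y 1 (f \o h) (derive1 f (h y) * derive1 h y).
  by move=> fs hs y; exact: (is_derive1_comp (smd f fs (h y)) (smd h hs y)).
have compE (f h : R -> R) : smooth f -> smooth h -> forall y : R,
    derive1 (f \o h) y = derive1 f (h y) * derive1 h y.
  by move=> fs hs y; rewrite [LHS]derive1E; have [] := compd f h fs hs y.
have compd' (f h : R -> R) : smooth f -> smooth h -> forall y : R,
    is_derive y 1 (f \o h) (derive1 (f \o h) y).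
  by move=> fs hs y; rewrite compE//; exact: compd.
have m1 : (-1 : R) \in `[-1, 1] by rewrite in_itv/= lexx (le_trans _ ler01)// oppr_le0.
have p1 : (1 : R) \in `[-1, 1] by rewrite in_itv/= lexx andbT (le_trans _ ler01)// oppr_le0.
have dgm_ge0 y : 0 <= derive1 gm y by rewrite -A0_m (le_trans (ltW c1_gt0))// A0_ge.
have dgp_ge0 y : 0 <= derive1 gp y by rewrite -A0_p (le_trans (ltW c1_gt0))// A0_ge.
exists sig, u0; do 2 (split; first by []).
split; first exact: (monotone_BV_line s1 u0_mono (fun x => itvC _ (u0_range x))).
split.
  apply: (dissipative_conservation s1 u0_mono u0_range _ dleft (smd _ gm_smooth) (compd' _ _ fm_smooth gm_smooth)).
  by rewrite /= in_itv/= ltxx.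
split.
  apply: (dissipative_conservation s1 u0_mono u0_range _ dright (smd _ gp_smooth) (compd' _ _ fp_smooth gp_smooth)).
  by rewrite /= in_itv/= ltxx.
split.
  move=> eta qm qp ec ed hm hp; split.
    exact: (dissipative_entropy dleft (smd _ gm_smooth) dgm_ge0
      (compE _ _ fm_smooth gm_smooth) ec ed hm).
  exact: (dissipative_entropy dright (smd _ gp_smooth) dgp_ge0
      (compE _ _ fp_smooth gp_smooth) ec ed hp).
split.
  apply/cvgrPdist_lt => d d0; near=> x.
  have xm : x <= - m by near: x; apply: nbhs_ninfty_le; exact: num_real.
  by rewrite u0l// subrr normr0.
apply/cvgrPdist_lt => d d0; near=> x.
have xm : m <= x by near: x; apply: nbhs_pinfty_ge; exact: num_real.
by rewrite u0r// subrr normr0.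
Unshelve. all: by end_near. Qed.
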